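(* The zero locus in $OG(2,12)$ of a general global section of the spinor bundle $\mathcal{S}_+$ is isomorphic to $Fl_6$.
   Context: Over $\mathbb{C}$. $OG(2,12)$ is the orthogonal Grassmannian of isotropic planes $U$ in $V=\mathbb{C}^{12}$ with a non-degenerate quadratic form. Write $V=E\oplus F$ with $E,F$ maximal isotropic, $F\simeq E^\vee$. The half-spin representations of $Spin_{12}$ are $\Delta_+=\wedge^{even}E$, $\Delta_-=\wedge^{odd}E$, with Clifford action $V\otimes\Delta_\pm\to\Delta_\mp$ ($E$ acts by wedge product, $F$ by contraction). The spinor bundle $\mathcal{S}_+$ on $OG(2,12)$ is the homogeneous bundle of rank $8$ whose fiber at $[U]$ is the cokernel of $U\otimes\Delta_-\to\Delta_+$; $H^0(\mathcal{S}_+)=\Delta_+$. $Fl_n$ denotes the adjoint variety of $SL_n$, i.e. the incidence variety of pairs (point, hyperplane containing it) in $\mathbb{P}^{n-1}\times\check{\mathbb{P}}^{n-1}$. *)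

(* Defs.v *)
From HB Require Import structures.
From mathcomp Require Import all_boot all_order all_algebra.
From mathcomp Require Import boolp classical_sets reals.
From mathcomp Require Import complex ring.
From mathcomp Require mpoly.

Set Implicit Arguments.
Unset Strict Implicit.
Unset Printing Implicit Defensive.

Import GRing.Theory.
Local Open Scope classical_set_scope.
Local Open Scope ring_scope.

(* Schemes over a field k are represented by their functors of points on
   commutative k-algebras.  By Yoneda's lemma (and since a scheme is covered by
   affine ones), two k-schemes are isomorphic iff these functors are naturally
   isomorphic.  The zero ring, which is not a [comAlgType], is irrelevant: every
   scheme has exactly one point over it. *)

Record alg_functor (k : fieldType) := AlgFunctor {
  point : comAlgType k -> Type;
  base_change : forall A B : comAlgType k,
    {lrmorphism A -> B} -> point A -> point B;
  base_change_id : forall (A : comAlgType k) (x : point A),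
    base_change (idfun : {lrmorphism A -> A}) x = x;
  base_change_comp : forall (A B D : comAlgType k)
      (f : {lrmorphism A -> B}) (g : {lrmorphism B -> D}) (x : point A),
    base_change (g \o f : {lrmorphism A -> D}) x
      = base_change g (base_change f x)
}.

Definition isomorphic (k : fieldType) (X Y : alg_functor k) : Prop :=
  exists phi : forall A : comAlgType k, point X A -> point Y A,
    (forall A, bijective (phi A)) /\
    (forall (A B : comAlgType k) (f : {lrmorphism A -> B}) (x : point X A),
       phi B (base_change f x) = base_change f (phi A x)).

Definition submodule (A : comNzRingType) (n : nat) (U : set 'rV[A]_n) : Prop :=
  U 0 /\ forall (a : A) (u v : 'rV[A]_n), U u -> U v -> U (a *: u + v).

Definition span (A : comNzRingType) (n : nat) (X : set 'rV[A]_n) :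
    set 'rV[A]_n :=
  [set v | forall U, submodule U -> X `<=` U -> U v].

(* For a direct summand U of A^n this is U \otimes_A B, viewed in B^n. *)
Definition extend (A B : comNzRingType) (f : {rmorphism A -> B}) (n : nat)
    (U : set 'rV[A]_n) : set 'rV[B]_n :=
  span [set map_mx f u | u in U].

Definition complement (A : comNzRingType) (n : nat) (U W : set 'rV[A]_n) :
    Prop :=
  (forall v, exists u w, [/\ U u, W w & v = u + w]) /\ U `&` W = [set 0].

(* The rank is r at every point of Spec A. *)
Definition constant_rank (A : comNzRingType) (n r : nat) (U : set 'rV[A]_n) :
    Prop :=
  forall (K : fieldType) (f : {rmorphism A -> K}),
    exists2 M : 'M[K]_(r, n), row_free M &
      extend f U = [set w | (w <= M)%MS].

(* The A-points of the Grassmannian of r-dimensional subspaces of an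
   n-dimensional space. *)
Definition grassmannian (A : comNzRingType) (n r : nat) (U : set 'rV[A]_n) :
    Prop :=
  [/\ submodule U,
      exists2 W, submodule W & complement U W &
      constant_rank r U].

(* V = E + F, where E = A^n has basis e_0, ..., e_(n-1), F is the dual of E with
   the dual basis, and the quadratic form is q(e + f) = <f, e>.  A vector of V is
   a row of length n + n: E-coordinates first, F-coordinates last. *)

Definition quad (A : comNzRingType) (n : nat) (v : 'rV[A]_(n + n)) : A :=
  \sum_(i < n) lsubmx v 0 i * rsubmx v 0 i.

Definition orthogonal_grassmannian (A : comNzRingType) (n r : nat)
    (U : set 'rV[A]_(n + n)) : Prop :=
  grassmannian r U /\ (forall u, U u -> quad u = 0).

(* The exterior algebra of E: x S is the coefficient of x on the basis vector
   e_S, the wedge product of the e_j, j \in S, in increasing order. *)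
Definition spinor (A : comNzRingType) (n : nat) : Type :=
  {ffun {set 'I_n} -> A}.

Definition even_spinor (A : comNzRingType) (n : nat) : set (spinor A n) :=
  [set x | forall S : {set 'I_n}, odd #|S| -> x S = 0].

Definition odd_spinor (A : comNzRingType) (n : nat) : set (spinor A n) :=
  [set x | forall S : {set 'I_n}, ~~ odd #|S| -> x S = 0].

Definition ext_sign (A : comNzRingType) (n : nat) (i : 'I_n)
    (S : {set 'I_n}) : A :=
  (-1) ^+ #|[set j in S | (j < i)%N]|.

(* For i \notin T, e_i /\ e_T = ext_sign i T e_(i |: T), and for i \in T the
   contraction of e_T by the dual vector of e_i is ext_sign i T e_(T :\ i).
   Hence the coefficient on e_S of the action of e_i (resp. of its dual vector)
   on x comes from x (S :\ i) if i \in S (resp. from x (i |: S) if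
   i \notin S); note ext_sign i (S :\ i) = ext_sign i S. *)
Definition clifford (A : comNzRingType) (n : nat) (v : 'rV[A]_(n + n))
    (x : spinor A n) : spinor A n :=
  [ffun S : {set 'I_n} => \sum_(i < n)
     if i \in S then lsubmx v 0 i * (ext_sign A i S * x (S :\ i))
     else rsubmx v 0 i * (ext_sign A i S * x (i |: S))].

(* The image of the map from U \otimes Delta_- to Delta_+; the fiber of the
   spinor bundle at U is the quotient of Delta_+ by it. *)
Definition clifford_image (A : comNzRingType) (n : nat)
    (U : set 'rV[A]_(n + n)) : set (spinor A n) :=
  [set y | exists (m : nat) (u : 'I_m -> 'rV[A]_(n + n))
                  (x : 'I_m -> spinor A n),
     [/\ forall i, U (u i), forall i, odd_spinor (x i) &
         y = \sum_(i < m) clifford (u i) (x i)]].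

Definition scalar_spinor (k : fieldType) (A : comAlgType k) (n : nat)
    (s : spinor k n) : spinor A n :=
  [ffun S => (s S)%:A].

(* The A-points of the zero locus of the section s: those U over which the
   image of s in the cokernel vanishes. *)
Definition zero_locus_point (k : fieldType) (n r : nat) (s : spinor k n)
    (A : comAlgType k) (U : set 'rV[A]_(n + n)) : Prop :=
  orthogonal_grassmannian r U /\ clifford_image U (scalar_spinor A s).

(* A hyperplane is given by the line of linear forms vanishing on it. *)
Definition flag_point (A : comNzRingType) (n : nat)
    (LH : set 'rV[A]_n * set 'rV[A]_n) : Prop :=
  [/\ grassmannian 1 LH.1, grassmannian 1 LH.2 &
      forall l h, LH.1 l -> LH.2 h -> l *m h^T = 0].

Lemma span_submodule (A : comNzRingType) (n : nat) (X : set 'rV[A]_n) :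
  submodule (span X).
Proof.
split=> [U [U0 _] _ //|a u v Xu Xv U sU XU].
by apply: sU.2; [apply: Xu|apply: Xv].
Qed.

Lemma sub_span (A : comNzRingType) (n : nat) (X : set 'rV[A]_n) :
  X `<=` span X.
Proof. by move=> v Xv U _; apply. Qed.

Lemma submodule_sum (A : comNzRingType) (n : nat) (U : set 'rV[A]_n)
    (I : finType) (c : I -> A) (u : I -> 'rV[A]_n) :
  submodule U -> (forall i, U (u i)) -> U (\sum_i c i *: u i).
Proof.
move=> sU Uu; elim/big_rec: _ => [|i v _ Uv]; first by case: sU.
by apply: sU.2.
Qed.

Lemma extend_sub (A B : comNzRingType) (f : {rmorphism A -> B}) (n : nat)
    (U : set 'rV[A]_n) (W : set 'rV[B]_n) :
  submodule W -> (forall u, U u -> W (map_mx f u)) -> extend f U `<=` W.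
Proof. by move=> sW UW v; apply=> // _ [u /UW Wu <-]. Qed.

Lemma mem_extend (A B : comNzRingType) (f : {rmorphism A -> B}) (n : nat)
    (U : set 'rV[A]_n) (u : 'rV[A]_n) : U u -> extend f U (map_mx f u).
Proof. by move=> Uu; apply: sub_span; exists u. Qed.

Lemma eq_extend (A B : comNzRingType) (f g : {rmorphism A -> B}) (n : nat)
    (U : set 'rV[A]_n) : f =1 g -> extend f U = extend g U.
Proof.
move=> fg; congr span; apply/seteqP; split=> _ [u Uu <-];
  by exists u => //; apply/matrixP => i j; rewrite !mxE fg.
Qed.

Lemma extend_id (A : comNzRingType) (n : nat) (U : set 'rV[A]_n)
    (f : {rmorphism A -> A}) : f =1 id -> submodule U -> extend f U = U.
Proof.
move=> fid sU.
have fE u : map_mx f u = u :> 'rV[A]_n.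
  by apply/matrixP => i j; rewrite mxE fid.
apply/seteqP; split=> [|u Uu]; first by apply: extend_sub => // u; rewrite fE.
by rewrite -[u]fE; apply: mem_extend.
Qed.

Lemma extend_comp (A B D : comNzRingType) (f : {rmorphism A -> B})
    (g : {rmorphism B -> D}) (h : {rmorphism A -> D}) (n : nat)
    (U : set 'rV[A]_n) :
  h =1 g \o f -> extend h U = extend g (extend f U).
Proof.
move=> hE.
have mE u : map_mx h u = map_mx g (map_mx f u) :> 'rV[D]_n.
  by apply/matrixP => i j; rewrite !mxE hE.
apply/seteqP; split; apply: extend_sub; try exact: span_submodule.
  by move=> u Uu; rewrite mE; do 2! apply: mem_extend.
apply: extend_sub => [|u Uu] /=; last by rewrite -mE; apply: mem_extend.
have [U0 UD] := @span_submodule _ _ [set map_mx h u | u in U].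
by split=> [|a u v Uu Uv] /=; rewrite ?map_mx0 // map_mxD map_mxZ; apply: UD.
Qed.

Lemma complement_mx (A : comNzRingType) (n : nat) (U W : set 'rV[A]_n) :
    submodule U -> submodule W -> complement U W ->
  exists p : 'M[A]_n, [/\ p *m p = p, U = [set v | v *m p = v] &
    W = [set v | v *m p = 0]].
Proof.
move=> sU sW [sumUW capUW].
have /choice[u /choice[w uwP]] := fun i : 'I_n => sumUW (delta_mx 0 i).
pose p : 'M[A]_n := \matrix_i u i.
have Up v : U (v *m p).
  rewrite mulmx_sum_row; apply: submodule_sum => // i.
  by rewrite rowK; case: (uwP i).
have Wp v : W (v - v *m p).
  have -> : v - v *m p = \sum_i v 0 i *: w i.
    rewrite {1}(row_sum_delta v) mulmx_sum_row -sumrB; apply: eq_bigr => i _.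
    by rewrite rowK -scalerBr; case: (uwP i) => _ _ ->; rewrite addrC addKr.
  by apply: submodule_sum => // i; case: (uwP i).
have cap0 v : U v -> W v -> v = 0.
  by move=> Uv Wv; have : (U `&` W) v by []; rewrite capUW.
have UB x y : U x -> U y -> U (x - y).
  by move=> Ux Uy; rewrite addrC -scaleN1r; apply: sU.2.
have WB x y : W x -> W y -> W (x - y).
  by move=> Wx Wy; rewrite addrC -scaleN1r; apply: sW.2.
have UE v : U v -> v *m p = v.
  by move=> Uv; apply/esym/eqP; rewrite -subr_eq0; apply/eqP/cap0 => //; apply: UB.
exists p; split.
- by apply/row_matrixP => i; rewrite row_mul UE // rowE.
- by apply/seteqP; split=> v /= => [/UE|<-].
- apply/seteqP; split=> v /= => [Wv|vp0]; last by have := Wp v; rewrite vp0 subr0.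
  by apply: cap0 => //; rewrite -[_ *m _](subKr v); apply: WB.
Qed.

Lemma extend_mx (A B : comNzRingType) (f : {rmorphism A -> B}) (n : nat)
    (p : 'M[A]_n) : p *m p = p ->
  extend f [set v | v *m p = v] = [set v | v *m map_mx f p = v].
Proof.
move=> pp; apply/seteqP; split.
  apply: extend_sub => [|u /= up]; last by rewrite -map_mxM up.
  split=> [|a u v /= up vp]; first by rewrite /= mul0mx.
  by rewrite mulmxDl -scalemxAl up vp.
move=> v /= <-; rewrite mulmx_sum_row.
apply: submodule_sum => [|i]; first exact: span_submodule.
by rewrite -map_row; apply: mem_extend; rewrite /= -row_mul pp.
Qed.

Lemma grassmannian_extend (A B : comNzRingType) (f : {rmorphism A -> B})
    (n r : nat) (U : set 'rV[A]_n) :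
  grassmannian r U -> grassmannian r (extend f U).
Proof.
case=> sU [W sW cUW] rU; split; first exact: span_submodule.
  have [p [pp UE _]] := complement_mx sU sW cUW.
  have fpp : map_mx f p *m map_mx f p = map_mx f p by rewrite -map_mxM pp.
  rewrite UE extend_mx //.
  exists [set v | v *m map_mx f p = 0].
    split=> [|a u v /= up vp]; first by rewrite /= mul0mx.
    by rewrite mulmxDl -scalemxAl up vp scaler0 addr0.
  split=> [v|].
    exists (v *m map_mx f p), (v - v *m map_mx f p); split=> /=.
    - by rewrite -mulmxA fpp.
    - by rewrite mulmxBl -mulmxA fpp subrr.
    - by rewrite addrC subrK.
  by apply/seteqP; split=> v /= => [[vp vp0]|->]; rewrite ?mul0mx // -vp vp0.
move=> K g; have [M fM ME] := rU K (g \o f : {rmorphism A -> K}).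
by exists M; rewrite // -ME -(@extend_comp _ _ _ f g (g \o f)).
Qed.

Lemma quad_extend (A B : comNzRingType) (f : {rmorphism A -> B}) (n : nat)
    (U : set 'rV[A]_(n + n)) :
    submodule U -> (forall u, U u -> quad u = 0) ->
  forall v, extend f U v -> quad v = 0.
Proof.
move=> sU qU.
pose b (D : comNzRingType) (u v : 'rV[D]_(n + n)) : D :=
  \sum_(i < n) (lsubmx u 0 i * rsubmx v 0 i + lsubmx v 0 i * rsubmx u 0 i).
have bC (D : comNzRingType) (u v : 'rV[D]_(n + n)) : b D u v = b D v u.
  by apply: eq_bigr => i _; rewrite addrC.
have bl (D : comNzRingType) a (u v w : 'rV[D]_(n + n)) :
    b D (a *: u + v) w = a * b D u w + b D v w.
  by rewrite mulr_sumr -big_split; apply: eq_bigr => i _ /=; rewrite !mxE; ring.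
have b0 (D : comNzRingType) (w : 'rV[D]_(n + n)) : b D 0 w = 0.
  by apply: big1 => i _; rewrite !mxE mulr0 mul0r addr0.
have quadD (D : comNzRingType) a (u v : 'rV[D]_(n + n)) :
    quad (a *: u + v) = a * a * quad u + a * b D u v + quad v.
  by rewrite !mulr_sumr -!big_split; apply: eq_bigr => i _ /=; rewrite !mxE; ring.
have bf u v : b B (map_mx f u) (map_mx f v) = f (b A u v).
  by rewrite rmorph_sum; apply: eq_bigr => i _; rewrite !mxE rmorphD !rmorphM.
have bU u v : U u -> U v -> b A u v = 0.
  move=> Uu Uv; have := quadD _ 1 u v.
  by rewrite !qU ?mulr0 ?add0r ?addr0 ?mul1r //; apply: sU.2.
have sub_b (w : 'rV[B]_(n + n)) : submodule [set v | b B v w = 0].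
  by split=> [|a u v /= uw vw] /=; rewrite ?b0 // bl uw vw mulr0 addr0.
have bV1 v w : extend f U v -> U w -> b B v (map_mx f w) = 0.
  move=> Uv Uw; move: v Uv; apply: extend_sub => [|u Uu] /=; first exact: sub_b.
  by rewrite bf bU // rmorph0.
have bV v w : extend f U v -> extend f U w -> b B v w = 0.
  move=> Uv; rewrite bC; move: w; apply: extend_sub => [|u Uu] /=.
    exact: sub_b.
  by rewrite bC bV1.
suff sub : extend f U `<=` extend f U `&` [set v | quad v = 0].
  by move=> v /sub[].
have [V0 VD] := @span_submodule _ _ [set map_mx f u | u in U].
apply: extend_sub => [|u Uu].
  split=> [|a u v [Uu /= qu] [Uv /= qv]].
    by split=> //=; apply: big1 => i _; rewrite !mxE mulr0.
  by split; [apply: VD|rewrite /= quadD qu qv (bV u v) // !mulr0 !addr0].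
split; first exact: mem_extend.
have fq : quad (map_mx f u) = f (quad u).
  by rewrite rmorph_sum; apply: eq_bigr => i _; rewrite !mxE rmorphM.
by rewrite /= fq qU // rmorph0.
Qed.

Lemma clifford_map (A B : comNzRingType) (f : {rmorphism A -> B}) (n : nat)
    (v : 'rV[A]_(n + n)) (x : spinor A n) :
  clifford (map_mx f v) [ffun S => f (x S)]
    = [ffun S => f (clifford v x S)] :> spinor B n.
Proof.
apply/ffunP => S; rewrite !ffunE rmorph_sum; apply: eq_bigr => i _.
by case: ifP; rewrite !mxE !ffunE !rmorphM rmorphXn rmorphN1.
Qed.

Lemma zero_locus_extend (k : fieldType) (n r : nat) (s : spinor k n)
    (A B : comAlgType k) (f : {lrmorphism A -> B}) (U : set 'rV[A]_(n + n)) :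
  zero_locus_point r s U -> zero_locus_point r s (extend f U).
Proof.
case=> [[gU qU] [m [u [x [Uu ox sE]]]]]; split; first split.
- exact: grassmannian_extend.
- by apply: quad_extend => //; case: gU.
exists m, (fun i => map_mx f (u i)), (fun i => [ffun S => f (x i S)]); split.
- by move=> i; apply: mem_extend.
- by move=> i S oS; rewrite ffunE ox // rmorph0.
apply/ffunP => S; rewrite sum_ffunE.
under eq_bigr do rewrite clifford_map ffunE.
rewrite -rmorph_sum -sum_ffunE -sE !ffunE.
by have := rmorph_alg f (s S) => /= ->.
Qed.

Lemma flag_extend (A B : comNzRingType) (f : {rmorphism A -> B}) (n : nat)
    (LH : set 'rV[A]_n * set 'rV[A]_n) :
  flag_point LH -> flag_point (extend f LH.1, extend f LH.2).
Proof.
case=> gL gH LH0; split; try exact: grassmannian_extend.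
move=> l h /= Ll; move: h; apply: extend_sub => [|h Hh].
  split=> [|a u v /= lu lv] /=; first by rewrite trmx0 mulmx0.
  by rewrite linearD linearZ /= mulmxDr -scalemxAr lu lv scaler0 addr0.
move: l Ll; apply: extend_sub => [|l Ll] /=.
  split=> [|a u v /= uh vh] /=; first by rewrite mul0mx.
  by rewrite mulmxDl -scalemxAl uh vh scaler0 addr0.
by rewrite map_trmx -map_mxM LH0 // map_mx0.
Qed.

(* The zero locus in OG(r, 2n) of the section s of the spinor bundle S_+. *)
Definition zero_locus (k : fieldType) (n r : nat) (s : spinor k n) :
  alg_functor k.
Proof.
refine (@AlgFunctor k
  (fun A => {U : set 'rV[A]_(n + n) | zero_locus_point r s U})
  (fun A B f x => exist _ (extend f (sval x)) (zero_locus_extend f (svalP x)))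
  _ _).
- move=> A [U zU]; apply: eq_exist => /=.
  by apply: extend_id => //; case: zU => [[[]]].
- move=> A B D f g [U zU]; apply: eq_exist => /=.
  exact: extend_comp.
Defined.

Definition flag_variety (k : fieldType) (n : nat) : alg_functor k.
Proof.
refine (@AlgFunctor k
  (fun A => {LH : set 'rV[A]_n * set 'rV[A]_n | flag_point LH})
  (fun A B f x => exist _ (extend f (sval x).1, extend f (sval x).2)
                        (flag_extend f (svalP x)))
  _ _).
- move=> A [[L H] [[sL ? ?] [sH ? ?] ?]]; apply: eq_exist => /=.
  by rewrite !extend_id.
- move=> A B D f g [[L H] ?]; apply: eq_exist => /=.
  by congr (_, _); apply: extend_comp.
Defined.

Definition zariski_closed (k : fieldType) (I : finType)
    (Z : set {ffun I -> k}) : Prop :=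
  exists P : set (mpoly.mpoly #|I| k),
    Z = [set x | forall p, P p ->
                   mpoly.meval (fun i => x (enum_val i)) p = 0].

(* Q holds for the general element of the linear subspace D: on a nonempty
   Zariski open subset of D. *)
Definition for_general (k : fieldType) (I : finType) (D : set {ffun I -> k})
    (Q : {ffun I -> k} -> Prop) : Prop :=
  exists Z : set {ffun I -> k}, [/\ zariski_closed Z, ~ (D `<=` Z) &
    forall x, D x -> ~ Z x -> Q x].

(* Main.v *)
(* Let s = a + b e_[6] with a and b nonzero, a combination of the pure spinors
   of the maximal isotropic subspaces F and E. If the plane U spanned by u and v is
   isotropic and s lies in U . Delta_-, then u . v . s = 0 in the Clifford
   module. The coefficients of degree 2 and 4 of this spinor are a times the
   wedge product of the E-components of u and v and b times (the dual of) that
   of their F-components, so both projections of U have rank one and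
   U = (U \cap E) + (U \cap F): a line in E and a line in F = E^* that are
   orthogonal, i.e. a point of Fl_6. Conversely L + H lies in the zero locus
   because 1 and e_[6] are obtained from H and from L. Over an algebra the
   module U is only locally free, and these equalities are checked up to a
   multiplier outside each maximal ideal.

   A general s is brought to this form by elements 1 + t u v of the spin group
   (u, v isotropic and orthogonal), which do not change the zero locus up to
   isomorphism. They first kill all coefficients of s except those on 1, e_0123,
   e_0145, e_2345 and e_[6], rationally in s. What is left is a tensor in
   (k^2)^{\otimes 3}; when its hyperdeterminant is nonzero, it is a sum of two
   decomposable tensors in general position, hence equivalent under SL_2^3 to a
   combination of 1 and e_[6]. *)

Require Import Defs.
From HB Require Import structures.
From mathcomp Require Import all_boot all_order all_algebra.
From mathcomp Require Import boolp classical_sets reals.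
From mathcomp Require Import complex ring zify.
From mathcomp Require mpoly.

Set Implicit Arguments.
Unset Strict Implicit.
Unset Printing Implicit Defensive.

Import GRing.Theory Num.Theory.
Local Open Scope classical_set_scope.
Local Open Scope ring_scope.

(** * Residue fields *)

Definition ideal (A : comNzRingType) (I : set A) : Prop :=
  I 0 /\ forall a x y, I x -> I y -> I (a * x + y).

(** Zorn's lemma. Maximality is recorded in the form used for residue fields: every element outside
    [M] is invertible modulo [M]. *)
Lemma maximal_idealP (A : comNzRingType) (I : set A) : ideal I -> ~ I 1 ->
  exists M : set A, [/\ ideal M, I `<=` M, ~ M 1 &
    forall x, ~ M x -> exists a, M (1 - a * x)].
Proof.
move=> [I0 ID] I1.
(* [Zorn_bigcup] also asks for the union of the empty chain. Adjoining [I] to every set makes that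
   union stand for [I] itself. *)
pose P (J : set A) := ideal (I `|` J) /\ ~ (I `|` J) 1.
have [F FP totF|J [[idJ J1] Jmax]] := @Zorn_bigcup A P.
  split=> [|[//|[X /FP[_ X1] Xx]]]; last by apply: X1; right.
  split=> [|a x y]; first by left.
  have in1 X z : F X -> (I `|` X) z -> (I `|` \bigcup_(X in F) X) z.
    by by move=> FX [Iz|Xz]; [left|right; exists X].
  case=> [Ix|[X FX Xx]] [Iy|[Y FY Yy]].
  - by left; apply: ID.
  - by apply: (in1 Y) => //; apply: (FP _ FY).1.2; [left|right].
  - by apply: (in1 X) => //; apply: (FP _ FX).1.2; [right|left].
  - have [XY|YX] := totF _ _ FX FY.
      by apply: (in1 Y) => //; apply: (FP _ FY).1.2; right => //; apply: XY.
    by apply: (in1 X) => //; apply: (FP _ FX).1.2; right => //; apply: YX.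
exists (I `|` J); split=> // x nJx.
have [J0 JD] := idJ.
pose X := [set z | exists a y, (I `|` J) y /\ z = a * x + y].
have IX : I `|` X = X.
  apply/setUidPr => z Iz; exists 0, z; split; first by left.
  by rewrite mul0r add0r.
have idX : ideal X.
  split; first by exists 0, 0; split=> //; rewrite mul0r add0r.
  move=> a _ _ [b [y [Jy ->]]] [c [z [Jz ->]]].
  by exists (a * b + c), (a * y + z); split; [apply: JD|ring].
have JX : J `<` X.
  split=> [y Jy|/(_ x) XJ]; first by exists 0, y; split; [right|ring].
  by apply: nJx; right; apply: XJ; exists 1, 0; split; [|ring].
have {Jmax}/not_andP[] := Jmax _ JX; rewrite IX // => /contrapT[a [y [Jy e]]].
by exists a; rewrite e addrAC subrr add0r.
Qed.

Lemma exists_residue_field (A : comNzRingType) (I : set A) :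
    ideal I -> ~ I 1 ->
  exists (K : fieldType) (f : {rmorphism A -> K}),
    (forall y, exists x, f x = y) /\ (forall x, I x -> f x = 0).
Proof.
move=> idI I1; have [M [[M0 MD] IM M1 Mmax]] := maximal_idealP idI I1.
pose m (x : A) : bool := `[< M x >].
have mP : idealr_closed m.
  split=> [||a u v /asboolP Mu /asboolP Mv]; rewrite /in_mem /=.
  - exact/asboolP.
  - exact/asboolP.
  - by apply/asboolP; apply: MD.
pose mI : idealr A := HB.pack m (isIdealr.Build A m mP).
pose Q : comNzRingType := {ideal_quot mI}.
pose p : {rmorphism A -> Q} := \pi_{ideal_quot mI}%qT.
have p0 x : (p x == 0) = m x.
  by rewrite -(rmorph0 p) /p /= -Quotient.idealrBE subr0.
have psurj (y : Q) : exists x, p x = y by exists (repr y); rewrite /p /= reprK.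
have inv_ex (y : Q) : exists z, y != 0 -> z * y = 1.
  have [x <-] := psurj y; rewrite p0.
  have [_|/asboolP nMx] := boolP (m x); first by exists 0.
  have [a Ma] := Mmax _ nMx; exists (p a) => _.
  apply/esym/eqP; rewrite -subr_eq0 -rmorphM -(rmorph1 p) -rmorphB p0.
  exact/asboolP.
have [inv invP] := choice inv_ex.
(* A field structure requires the inverse of zero to be zero. *)
pose inv' (y : Q) := if y == 0 then 0 else inv y.
have inv'V (y : Q) : y != 0 -> inv' y * y = 1.
  by move=> y0; rewrite /inv' (negPf y0) invP.
have inv'0 : inv' 0 = 0 by rewrite /inv' eqxx.
pose K : fieldType := HB.pack (Quotient.quot mI)
  (GRing.ComNzRing_isField.Build Q inv'V inv'0).
exists K, (p : {rmorphism A -> K}); split=> // x Ix.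
by apply/eqP; rewrite p0; apply/asboolP; apply: IM.
Qed.

(** Otherwise [I] would vanish in the residue field of a maximal ideal containing it. Applied to the
    ideal of multipliers that make a statement true, this passes from multipliers outside each
    maximal ideal to the multiplier 1. *)
Lemma local_global (A : comNzRingType) (I : set A) : ideal I ->
  (forall (K : fieldType) (f : {rmorphism A -> K}),
     (forall y, exists x, f x = y) -> exists2 d, I d & f d != 0) ->
  I 1.
Proof.
move=> idI locI; apply: contrapT => I1.
have [K [f [fsurj fI]]] := exists_residue_field idI I1.
by have [d Id] := locI K f fsurj; rewrite fI // eqxx.
Qed.

(** * The Clifford action *)

(** Symmetric difference with the singleton of [i]. It merges wedge product and contraction into one
    formula, and flips are commuting involutions. *)
Definition flip (n : nat) (i : 'I_n) (S : {set 'I_n}) : {set 'I_n} :=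
  if i \in S then S :\ i else i |: S.

Lemma in_flip n (i j : 'I_n) (S : {set 'I_n}) :
  (j \in flip i S) = (j == i) (+) (j \in S).
Proof.
by rewrite /flip; case: ifP => iS; rewrite !inE; case: eqP => //= ->;
  rewrite iS.
Qed.

Lemma flipK n (i : 'I_n) : involutive (flip i).
Proof. by move=> S; apply/setP => j; rewrite !in_flip addKb. Qed.

Lemma flipC n (i j : 'I_n) (S : {set 'I_n}) :
  flip i (flip j S) = flip j (flip i S).
Proof. by apply/setP => l; rewrite !in_flip addbCA. Qed.

Lemma odd_flip n (i : 'I_n) (S : {set 'I_n}) : odd #|flip i S| = ~~ odd #|S|.
Proof.
rewrite /flip; case: ifP => iS; last by rewrite cardsU1 iS oddD.
by rewrite [in RHS](cardsD1 i) iS oddD /= negbK.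
Qed.

Lemma ext_sign_prod (A : comNzRingType) n (i : 'I_n) (S : {set 'I_n}) :
  ext_sign A i S = \prod_(j < n | (j < i)%N) (-1) ^+ (j \in S).
Proof.
rewrite /ext_sign -prodr_const big_mkcond [RHS]big_mkcond /=.
by apply: eq_bigr => j _; rewrite inE; case: (j \in S); case: (j < i)%N.
Qed.

Lemma ext_sign_flip (A : comNzRingType) n (i j : 'I_n) (S : {set 'I_n}) :
  ext_sign A j (flip i S) = (-1) ^+ (i < j)%N * ext_sign A j S.
Proof.
rewrite !ext_sign_prod.
under eq_bigr do rewrite in_flip signr_addb.
rewrite big_split; congr (_ * _) => /=.
case: ltnP => ij.
  rewrite (bigD1 i) //= eqxx big1 ?mulr1 // => l /andP[_ /negPf->].
  by rewrite expr0.
by apply: big1 => l lj; case: eqP => // le; move: lj; rewrite le ltnNge ij.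
Qed.

Lemma ext_sign_sqr (A : comNzRingType) n (i : 'I_n) (S : {set 'I_n}) :
  ext_sign A i S * ext_sign A i S = 1.
Proof. by rewrite -expr2 sqrr_sign. Qed.

(** The Boolean selects E ([true]) or F ([false]), so that in [cliffordE] it is just the membership
    of [i] in the target set. *)
Definition vcoord (A : comNzRingType) n (v : 'rV[A]_(n + n)) (b : bool)
    (i : 'I_n) : A :=
  if b then lsubmx v 0 i else rsubmx v 0 i.
Arguments vcoord : simpl never.

Lemma cliffordE (A : comNzRingType) n (v : 'rV[A]_(n + n)) (x : spinor A n) S :
  clifford v x S
    = \sum_i vcoord v (i \in S) i * (ext_sign A i S * x (flip i S)).
Proof. by rewrite ffunE; apply: eq_bigr => i _; rewrite /vcoord /flip;
  case: ifP. Qed.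

Lemma clifford2E (A : comNzRingType) n (u v : 'rV[A]_(n + n)) (x : spinor A n)
  S :
  clifford u (clifford v x) S = \sum_i \sum_j
    vcoord u (i \in S) i * vcoord v (j \in flip i S) j
      * (ext_sign A i S * ext_sign A j (flip i S) * x (flip j (flip i S))).
Proof.
rewrite cliffordE; apply: eq_bigr => i _; rewrite cliffordE !mulr_sumr.
by apply: eq_bigr => j _; ring.
Qed.

Lemma vcoordD (A : comNzRingType) n a (u v : 'rV[A]_(n + n)) b i :
  vcoord (a *: u + v) b i = a * vcoord u b i + vcoord v b i.
Proof. by case: b; rewrite /vcoord !mxE. Qed.

Lemma vcoordZ (A : comNzRingType) n a (u : 'rV[A]_(n + n)) b i :
  vcoord (a *: u) b i = a * vcoord u b i.
Proof. by case: b; rewrite /vcoord !mxE. Qed.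

Lemma vcoord_row_mx (A : comNzRingType) n (l h : 'rV[A]_n) b i :
  vcoord (row_mx l h) b i = if b then l 0 i else h 0 i.
Proof. by rewrite /vcoord row_mxKl row_mxKr. Qed.

Definition polar (A : comNzRingType) n (u v : 'rV[A]_(n + n)) : A :=
  \sum_i (vcoord u true i * vcoord v false i + vcoord v true i * vcoord u false
    i).

Lemma quadE (A : comNzRingType) n (u : 'rV[A]_(n + n)) :
  quad u = \sum_i vcoord u true i * vcoord u false i.
Proof. by []. Qed.

Lemma polarC (A : comNzRingType) n (u v : 'rV[A]_(n + n)) : polar u v = polar v
  u.
Proof. by apply: eq_bigr => i _; rewrite addrC. Qed.

Lemma quadD (A : comNzRingType) n a (u v : 'rV[A]_(n + n)) :
  quad (a *: u + v) = a * a * quad u + a * polar u v + quad v.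
Proof.
rewrite !quadE /polar !mulr_sumr -!big_split; apply: eq_bigr => i _ /=.
by rewrite !vcoordD; ring.
Qed.

(** Diagonal terms give the polar form because signs square to 1. For distinct [i] and [j],
    exchanging the two flips changes the sign, so these terms cancel. *)
Lemma clifford_polar (A : comNzRingType) n (u v : 'rV[A]_(n + n))
    (x : spinor A n) S :
  clifford u (clifford v x) S + clifford v (clifford u x) S = polar u v * x S.
Proof.
rewrite !clifford2E [X in _ + X]exchange_big -big_split mulr_suml.
apply: eq_bigr => i _; rewrite -big_split (bigD1 i) //= big1 ?addr0.
  rewrite flipK in_flip eqxx ext_sign_flip ltnn mul1r ext_sign_sqr mul1r.
  by rewrite -mulrDl; case: (i \in S) => /=; ring.
move=> j ji; rewrite !in_flip (negPf ji) eq_sym (negPf ji) /= flipC.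
rewrite !ext_sign_flip; have /orP : (i < j)%N || (j < i)%N.
  by rewrite -neq_ltn eq_sym.
by case=> ij; rewrite ij (ltnNge, ltnNge) (ltnW ij) /=; ring.
Qed.

(** Since 2 may fail to be invertible, this does not follow from [clifford_polar] with [u = v]. The
    terms with [i < j] are cancelled directly against those with [j < i]. *)
Lemma clifford_quad (A : comNzRingType) n (u : 'rV[A]_(n + n)) (x : spinor A n)
  S :
  clifford u (clifford u x) S = quad u * x S.
Proof.
pose F (i j : 'I_n) := vcoord u (i \in S) i * vcoord u (j \in flip i S) j
  * (ext_sign A i S * ext_sign A j (flip i S) * x (flip j (flip i S))).
have Fii i : F i i = vcoord u true i * vcoord u false i * x S.
  rewrite /F flipK in_flip eqxx ext_sign_flip ltnn mul1r ext_sign_sqr mul1r.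
  by case: (i \in S); rewrite //= [X in X * _]mulrC.
have Fij (i j : 'I_n) : (i < j)%N -> F j i = - F i j.
  move=> ij; have ji : (i == j) = false by rewrite -val_eqE ltn_eqF.
  rewrite /F !in_flip ji eq_sym ji /= flipC !ext_sign_flip ij ltnNge (ltnW ij).
  by rewrite /=; ring.
rewrite clifford2E -/F quadE mulr_suml.
rewrite (eq_bigr (fun i => F i i + (\sum_(j < n | (i < j)%N) F i j
    + \sum_(j < n | (j < i)%N) F i j))) => [|i _].
  rewrite big_split /= (eq_bigr _ (fun i _ => Fii i)) big_split /=.
  rewrite [X in _ + (_ + X)](exchange_big_dep xpredT) //= -big_split /=.
  rewrite [X in _ + X]big1 ?addr0 // => i _; rewrite -big_split big1 // => j ij.
  by rewrite /= (Fij _ _ ij) addrN.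
rewrite (bigD1 i) //=; congr (_ + _).
rewrite (bigID (fun j : 'I_n => (i < j)%N)) /=; congr (_ + _).
  by apply: eq_bigl => j; rewrite -val_eqE /=; case: ltngtP.
by apply: eq_bigl => j; rewrite -val_eqE /=; case: ltngtP.
Qed.

(** * Points of Grassmannians *)

(** The projection along a complement presents [U] as the image of an idempotent matrix, whose rank
    over each field is the rank of [U] there. [grassmannian_idem] is the converse. *)
Lemma grassmannian_mx (A : comNzRingType) n r (U : set 'rV[A]_n) :
    grassmannian r U ->
  exists p : 'M[A]_n, [/\ p *m p = p, U = [set v | v *m p = v] &
    forall (K : fieldType) (f : {rmorphism A -> K}), \rank (map_mx f p) = r].
Proof.
case=> sU [W sW cUW] rU; have [p [pp UE _]] := complement_mx sU sW cUW.
exists p; split=> // K f; have [M /eqP rM ME] := rU K f.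
have fpp : map_mx f p *m map_mx f p = map_mx f p by rewrite -map_mxM pp.
rewrite UE extend_mx // in ME.
have inM (v : 'rV_n) : (v *m map_mx f p = v) = (v <= M)%MS :> Prop.
  exact: (congr1 (fun X : set _ => X v) ME).
rewrite -rM; apply/eqP; rewrite eqn_leq; apply/andP; split; apply: mxrankS.
  by apply/row_subP => i; rewrite -inM -row_mul fpp.
by apply/row_subP => i; have := row_sub i M; rewrite -inM => <-; apply: submxMl.
Qed.

Lemma grassmannian_idem (A : comNzRingType) n r (p : 'M[A]_n) : p *m p = p ->
    (forall (K : fieldType) (f : {rmorphism A -> K}), \rank (map_mx f p) = r) ->
  grassmannian r [set v | v *m p = v].
Proof.
move=> pp rp; split.
- split=> [|a u v /= up vp]; first by rewrite /= mul0mx.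
  by rewrite mulmxDl -scalemxAl up vp.
- exists [set v | v *m p = 0].
    split=> [|a u v /= up vp]; first by rewrite /= mul0mx.
    by rewrite mulmxDl -scalemxAl up vp scaler0 addr0.
  split=> [v|].
    exists (v *m p), (v - v *m p); split=> /=.
    + by rewrite -mulmxA pp.
    + by rewrite mulmxBl -mulmxA pp subrr.
    + by rewrite addrC subrK.
  by apply/seteqP; split=> v /= => [[vp vp0]|->]; rewrite ?mul0mx // -vp vp0.
- move=> K f; have fpp : map_mx f p *m map_mx f p = map_mx f p.
    by rewrite -map_mxM pp.
  rewrite extend_mx //; rewrite -(rp K f).
  exists (row_base (map_mx f p)); first exact: row_base_free.
  apply/seteqP; split=> v /=; rewrite eq_row_base; first by move=> <-;
    apply: submxMl.
  by case/submxP => w ->; rewrite -mulmxA fpp.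
Qed.

(* Nakayama's lemma, by Cramer's rule: locally a point of the Grassmannian is
   spanned by r elements. *)
Lemma local_basis (A : comNzRingType) n r (U : set 'rV[A]_n) (K : fieldType)
    (f : {rmorphism A -> K}) : (forall y, exists x, f x = y) ->
    grassmannian r U ->
  exists (D : A) (G : 'M[A]_(r, n)), [/\ f D != 0, forall i, U (row i G),
    row_free (map_mx f G) & forall u, U u -> exists c, D *: u = c *m G].
Proof.
move=> fsurj gU; have [p [pp UE rp]] := grassmannian_mx gU.
have [g fg] := choice fsurj.
have lift k l (X : 'M[K]_(k, l)) : map_mx f (map_mx g X) = X.
  by apply/matrixP => i j; rewrite !mxE fg.
have := row_base_free (map_mx f p); have := eq_row_base (map_mx f p).
move: (row_base _); rewrite rp => M Mp Mfree.
have fpp : map_mx f p *m map_mx f p = map_mx f p by rewrite -map_mxM pp.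
have [N MN] := row_freeP Mfree.
(* A basis of the fibre over [K] is lifted to [A] and then projected into [U]. *)
pose G := map_mx g M *m p; pose B := map_mx g N.
have fG : map_mx f G = M.
  rewrite map_mxM lift; have : (M <= map_mx f p)%MS by rewrite Mp.
  by case/submxP => X ->; rewrite -mulmxA fpp.
have Gp : G *m p = G by rewrite -mulmxA pp.
have fGB : map_mx f (G *m B) = 1%:M by rewrite map_mxM fG lift.
pose d := \det (G *m B); pose C := p *m B *m \adj (G *m B).
have fd : f d = 1 by rewrite -det_map_mx fGB det1.
(* [Q] vanishes over [K], so [d%:M - Q] has determinant 1 there. Since [(d%:M - Q) *m p = C *m G],
   its adjugate expresses [D *: u] through the rows of [G]. *)
pose Q := d *: p - C *m G.
have fQ : map_mx f Q = 0.
  rewrite /Q /C map_mxB map_mxZ fd scale1r !(map_mxM f (_ *m _)) (map_mxM f p)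
    map_mx_adj.
  rewrite fGB fG lift.
  have : (map_mx f p <= M)%MS by rewrite Mp.
  case/submxP => X ->; rewrite -[X *m M *m N]mulmxA MN mulmx1.
  have -> : \adj (1%:M : 'M[K]_r) = 1%:M.
    by have := mul_mx_adj (1%:M : 'M[K]_r); rewrite det1 mul1mx.
  by rewrite mulmx1 subrr.
exists (\det (d%:M - Q)), G; split.
- rewrite -det_map_mx map_mxB fQ subr0 map_scalar_mx fd.
  by rewrite det1 oner_eq0.
- by move=> i; rewrite UE /= -row_mul Gp.
- by rewrite fG.
- move=> u; rewrite UE /= => up; exists (u *m \adj (d%:M - Q) *m C).
  have QE : (d%:M - Q) *m p = C *m G.
    rewrite mulmxBl mul_scalar_mx /Q mulmxBl -scalemxAl pp -mulmxA Gp.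
    by rewrite opprB addrC subrK.
  rewrite -mulmxA -QE -!mulmxA [_ *m (_ *m p)]mulmxA mul_adj_mx.
  by rewrite mul_scalar_mx -scalemxAr up.
Qed.

(** * Bilinearity of the Clifford action, and its image on U *)

Definition spinor_scale (A : comNzRingType) n (a : A) (x : spinor A n) :
    spinor A n :=
  [ffun S => a * x S].

Lemma cliffordDl (A : comNzRingType) n (u v : 'rV[A]_(n + n)) (x : spinor A n) :
  clifford (u + v) x = clifford u x + clifford v x.
Proof.
apply/ffunP => S; rewrite !ffunE -big_split; apply: eq_bigr => i _ /=.
by rewrite !linearD !mxE; case: ifP => _; ring.
Qed.

Lemma cliffordZl (A : comNzRingType) n a (v : 'rV[A]_(n + n)) (x : spinor A n) :
  clifford (a *: v) x = spinor_scale a (clifford v x).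
Proof.
apply/ffunP => S; rewrite !ffunE mulr_sumr; apply: eq_bigr => i _ /=.
by rewrite !linearZ !mxE; case: ifP => _; ring.
Qed.

Lemma cliffordDr (A : comNzRingType) n (v : 'rV[A]_(n + n)) (x y : spinor A n) :
  clifford v (x + y) = clifford v x + clifford v y.
Proof.
apply/ffunP => S; rewrite !ffunE -big_split; apply: eq_bigr => i _ /=.
by rewrite !ffunE; case: ifP => _; ring.
Qed.

Lemma clifford0r (A : comNzRingType) n (v : 'rV[A]_(n + n)) :
  clifford v 0 = 0 :> spinor A n.
Proof.
apply/ffunP => S; rewrite cliffordE ffunE big1 // => i _.
by rewrite ffunE !mulr0.
Qed.

Lemma cliffordZr (A : comNzRingType) n (v : 'rV[A]_(n + n)) a (x : spinor A n) :
  clifford v (spinor_scale a x) = spinor_scale a (clifford v x).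
Proof.
apply/ffunP => S; rewrite [RHS]ffunE !cliffordE mulr_sumr.
by apply: eq_bigr => i _; rewrite ffunE; ring.
Qed.

Lemma clifford_image0 (A : comNzRingType) n (U : set 'rV[A]_(n + n)) :
  clifford_image U 0.
Proof.
exists 0, (fun=> 0), (fun=> 0); by split=> [[]|[]|]; rewrite ?big_ord0.
Qed.

Lemma clifford_imageD (A : comNzRingType) n (U : set 'rV[A]_(n + n)) v x y :
  U v -> odd_spinor x -> clifford_image U y ->
  clifford_image U (clifford v x + y).
Proof.
move=> Uv ox [m [u [z [Uu oz ->]]]].
exists m.+1, (fun i => oapp u v (unlift ord0 i)).
exists (fun i => oapp z x (unlift ord0 i)); split.
- by move=> i; case: unliftP => [j|] _; [apply: Uu|apply: Uv].
- by move=> i; case: unliftP => [j|] _; [apply: oz|apply: ox].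
- rewrite big_ord_recl unlift_none /=; congr (_ + _).
  by apply: eq_bigr => i _; rewrite liftK.
Qed.

Lemma clifford_image_sum (A : comNzRingType) n (U : set 'rV[A]_(n + n))
    (I : finType) (v : I -> 'rV[A]_(n + n)) (x : I -> spinor A n) y :
  (forall i, U (v i)) -> (forall i, odd_spinor (x i)) -> clifford_image U y ->
  clifford_image U (\sum_i clifford (v i) (x i) + y).
Proof.
move=> Uv ox Uy; elim: (index_enum I) => [|i r IH];
  first by rewrite big_nil add0r.
by rewrite big_cons -addrA; apply: clifford_imageD.
Qed.

Lemma clifford_image_ind (A : comNzRingType) n (U : set 'rV[A]_(n + n))
    (P : spinor A n -> Prop) :
  P 0 -> (forall x y, P x -> P y -> P (x + y)) ->
  (forall v x, U v -> odd_spinor x -> P (clifford v x)) ->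
  forall y, clifford_image U y -> P y.
Proof.
move=> P0 PD Pc _ [m [u [x [Uu ox ->]]]]; elim/big_ind: _ => // i _.
exact: Pc.
Qed.

Lemma clifford_image_morph (A : comNzRingType) n (U U' : set 'rV[A]_(n + n))
    (h : spinor A n -> spinor A n) :
  h 0 = 0 -> (forall x y, h (x + y) = h x + h y) ->
  (forall v x, U v -> odd_spinor x ->
     exists v' x', [/\ U' v', odd_spinor x' & h (clifford v x)
       = clifford v' x']) ->
  forall y, clifford_image U y -> clifford_image U' (h y).
Proof.
move=> h0 hD hc y imy.
(* With an arbitrary further summand [z], the induction adds one Clifford product at a time. *)
suff : forall z, clifford_image U' z -> clifford_image U' (h y + z).
  by move/(_ _ (clifford_image0 U')); rewrite addr0.
elim/clifford_image_ind: y / imy => [z|x y IHx IHy z imz|v x Uv ox z imz].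
- by rewrite h0 add0r.
- by rewrite hD -addrA; apply/IHx/IHy.
- by have [v' [x' [Uv' ox' ->]]] := hc v x Uv ox; apply: clifford_imageD.
Qed.

(** Both vectors square to zero and they anticommute, so [u v u = - u u v = 0] and [u v v = 0]. *)
Lemma clifford_isotropic_pair (A : comNzRingType) n (u v : 'rV[A]_(n + n))
    (x : spinor A n) :
    quad u = 0 -> quad v = 0 -> polar u v = 0 ->
  clifford u (clifford v (clifford u x)) = 0 /\
  clifford u (clifford v (clifford v x)) = 0.
Proof.
move=> qu qv uv; have sq w y : quad w = 0 -> clifford w (clifford w y)
  = 0 :> spinor A n.
  by move=> qw; apply/ffunP => S; rewrite clifford_quad qw mul0r ffunE.
split; last by rewrite sq // clifford0r.
suff -> : clifford v (clifford u x) = spinor_scale (-1)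
  (clifford u (clifford v x)).
  by rewrite cliffordZr sq //; apply/ffunP => S; rewrite !ffunE mulr0.
apply/ffunP => S; rewrite [RHS]ffunE mulN1r; apply/eqP.
by rewrite -addr_eq0 clifford_polar polarC uv mul0r.
Qed.

Lemma isotropic_polar (A : comNzRingType) n (U : set 'rV[A]_(n + n)) u v :
  submodule U -> (forall w, U w -> quad w = 0) -> U u -> U v -> polar u v = 0.
Proof.
move=> sU qU Uu Uv; have := quadD 1 u v.
by rewrite !qU ?mulr0 ?add0r ?addr0 ?mul1r //; apply: sU.2.
Qed.

(* In the Clifford algebra the product of three vectors of an isotropic plane
   vanishes; here the plane is spanned by u and v up to the scalar D. *)
Lemma clifford_image_pair (A : comNzRingType) n (U : set 'rV[A]_(n + n))
  D u v s :
    submodule U -> (forall w, U w -> quad w = 0) -> U u -> U v ->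
    (forall w, U w -> exists a b, D *: w = a *: u + b *: v) ->
    clifford_image U s ->
  forall S, D * clifford u (clifford v s) S = 0.
Proof.
move=> sU qU Uu Uv gen; elim/clifford_image_ind: s /.
- by move=> S; rewrite !clifford0r ffunE mulr0.
- by move=> x y IHx IHy S; rewrite !cliffordDr ffunE mulrDr IHx IHy addr0.
move=> w x Uw _ S; have [a [b e]] := gen w Uw.
have [uvu uvv] := clifford_isotropic_pair x (qU u Uu) (qU v Uv)
  (isotropic_polar sU qU Uu Uv).
have -> : D * clifford u (clifford v (clifford w x)) S
    = clifford u (clifford v (clifford (D *: w) x)) S.
  by rewrite cliffordZl !cliffordZr [RHS]ffunE.
rewrite e cliffordDl !cliffordDr !cliffordZl !cliffordZr uvu uvv.
by rewrite !ffunE !mulr0 addr0.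
Qed.

(** * Points of the zero locus split *)

(** Plücker coordinates of the plane spanned by [u] and [v]. Those with [b = c] belong to its
    projection to E or to F. *)
Definition vminor (A : comNzRingType) n (u v : 'rV[A]_(n + n)) (b : bool)
    (i : 'I_n) (c : bool) (j : 'I_n) : A :=
  vcoord u b i * vcoord v c j - vcoord v b i * vcoord u c j.

Lemma flip4P n (i j k l : 'I_n) (T : {set 'I_n}) : i != j ->
  (flip l (flip k (flip i (flip j T))) == T)
    = ((k == i) && (l == j)) || ((k == j) && (l == i)).
Proof.
move=> ij; apply/eqP/orP => [/setP e|].
  have := e i; have := e j; rewrite !in_flip !eqxx (eq_sym j i) (negPf ij).
  rewrite (eq_sym i k) (eq_sym i l) (eq_sym j k) (eq_sym j l).
  have [->|ki] := eqVneq k i.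
    by rewrite (negPf ij); case: (l == j) (j \in T) => [] []; left.
  have [->|li] := eqVneq l i; last by case: (i \in T).
  by rewrite (negPf ij); case: (k == j) (j \in T) => [] []; right.
by case=> /andP[/eqP-> /eqP->]; rewrite ?(flipC j i) !(flipK, flipC i j).
Qed.

(** Among the coefficients that two flips can bring to this set, only [s T] survives. The two orders
    of flipping [i] and [j] give the two terms of a minor. *)
Lemma clifford2_corner (A : comNzRingType) n (u v : 'rV[A]_(n + n))
    (s : spinor A n) T i j :
    i != j -> (forall k l, flip l (flip k (flip i (flip j T))) != T ->
               s (flip l (flip k (flip i (flip j T)))) = 0) ->
  clifford u (clifford v s) (flip i (flip j T))
    = (-1) ^+ (j < i)%N * (ext_sign A i T * ext_sign A j T) * s T
      * vminor u v (i \notin T) i (j \notin T) j.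
Proof.
move=> ij s0; have ji : (j == i) = false by rewrite eq_sym (negPf ij).
rewrite clifford2E (bigD1 i) //= (bigD1 j) //= big1 ?addr0; last first.
  by move=> l lj; rewrite s0 ?mulr0 // flip4P // eqxx (negPf lj) (negPf ij).
rewrite (bigD1 j) ?ji //= [X in _ + (_ + X)]big1 ?addr0; last first.
  move=> k /andP[ki kj]; apply: big1 => l _.
  by rewrite s0 ?mulr0 // flip4P // (negPf ki) (negPf kj).
rewrite (bigD1 i) //= big1 ?addr0; last first.
  by move=> l li; rewrite s0 ?mulr0 // flip4P // eqxx (negPf li) ji.
rewrite !(flipC i j) !flipK !in_flip !eqxx ji (negPf ij) !ext_sign_flip !ltnn.
rewrite /vminor !addTb !addFb; have : (i < j)%N || (j < i)%N by rewrite
  -neq_ltn.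
by case/orP => lt; rewrite lt ltnNge (ltnW lt) /=; ring.
Qed.

(** Four flips change at most four elements. Hence the coefficients at the empty and at the full set
    do not interfere in degrees 2 and [n - 2]. *)
Lemma flip4_neq_setC n (i j k l : 'I_n) (T : {set 'I_n}) : (4 < n)%N ->
  flip l (flip k (flip i (flip j T))) <> ~: T.
Proof.
move=> n4 /setP e; pose r := [:: i; j; k; l].
suff : (#|'I_n| <= #|r|)%N.
  by rewrite card_ord leqNgt (leq_ltn_trans (card_size r)).
apply/subset_leq_card/fintype.subsetP => x _; apply: contraT;
  rewrite !inE !negb_or.
case/and4P => xi xj xk xl; move: (e x).
by rewrite !in_flip !inE (negPf xi) (negPf xj) (negPf xk) (negPf xl) /=;
  case: (x \in T).
Qed.

(* A combination of two pure spinors, whose annihilators are F and E. *)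
Definition extremal_spinor (A : comNzRingType) n (a b : A) : spinor A n :=
  [ffun S => if S == finset.set0 then a else if S == finset.setT then b else 0].

Lemma clifford2_extremal (A : comNzRingType) n (a b : A) (u v : 'rV[A]_(n + n))
    (c : bool) i j : (4 < n)%N -> i != j ->
  exists (S : {set 'I_n}) (e : nat),
    clifford u (clifford v (extremal_spinor n a b)) S
      = (-1) ^+ e * (if c then a else b) * vminor u v c i c j.
Proof.
move=> n4 ij; pose T : {set 'I_n} := if c then finset.set0 else finset.setT.
have nT0 : finset.setT != finset.set0 :> {set 'I_n}.
  by apply/finset.set0Pn; exists i; rewrite inE.
have inT l : (l \notin T) = c by rewrite {}/T; case: c; rewrite inE.
exists (flip i (flip j T)); eexists; rewrite clifford2_corner //.
  rewrite !inT /ext_sign -!exprD; congr (_ * _ * _).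
  by rewrite ffunE /T {inT T}; case: c; rewrite ?eqxx // (negPf nT0).
move=> k l; have := @flip4_neq_setC _ i j k l T n4.
rewrite ffunE /T {inT T}; case: c; rewrite ?finset.setC0 ?finset.setCT =>
  /eqP/negPf nS /negPf nS'.
  by rewrite nS nS'.
by rewrite nS' nS.
Qed.

Lemma row_free2_minor (K : fieldType) n (G : 'M[K]_(2, n + n)) : row_free G ->
  exists b i c j, vminor (row 0 G) (row 1 G) b i c j != 0.
Proof.
rewrite -row_leq_rank -mxrank_tr => rG.
have fG : row_full G^T by rewrite /row_full eqn_leq rank_leq_col rG.
have := fullrowsub_unit fG; move: (fullrankfun _) => h; rewrite unitmxE unitfE.
have vc (l : 'I_2) k : exists b i, forall l, G l k = vcoord (row l G) b i.
  rewrite -(splitK k); case: (fintype.split k) => i /=.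
    by exists true, i => l'; rewrite /vcoord !mxE.
  by exists false, i => l'; rewrite /vcoord !mxE.
have [b [i bi]] := vc 0 (h 0); have [c [j cj]] := vc 0 (h 1).
rewrite (expand_det_row _ 0) big_ord_recl big_ord1 /cofactor !det_mx11 !mxE.
move=> d; exists b, i, c, j; move: d; rewrite /vminor -!bi -!cj.
apply: contraNneq => e.
have l01 : lift 0 0 = 1 :> 'I_2 by apply/val_inj.
have l10 : lift 1 0 = 0 :> 'I_2 by apply/val_inj.
by apply/eqP; rewrite !l01 l10 /= expr0 expr1 mul1r mulN1r mulrN.
Qed.

Lemma vcoord_map (A B : comNzRingType) (f : {rmorphism A -> B}) n
    (u : 'rV[A]_(n + n)) b i :
  vcoord (map_mx f u) b i = f (vcoord u b i).
Proof. by case: b; rewrite /vcoord !mxE. Qed.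

Lemma vminor_map (A B : comNzRingType) (f : {rmorphism A -> B}) n
    (u v : 'rV[A]_(n + n)) b i c j :
  vminor (map_mx f u) (map_mx f v) b i c j = f (vminor u v b i c j).
Proof. by rewrite /vminor !vcoord_map rmorphB !rmorphM. Qed.

Lemma vminor_swap (A : comNzRingType) n (u v : 'rV[A]_(n + n)) b i c j :
  vminor u v b i c j = - vminor u v c j b i.
Proof. by rewrite /vminor; ring. Qed.

Lemma eq_vcoord (A : comNzRingType) n (u v : 'rV[A]_(n + n)) :
  (forall b i, vcoord u b i = vcoord v b i) -> u = v.
Proof.
move=> uv; rewrite -[u]hsubmxK -[v]hsubmxK; congr row_mx; apply/rowP => i.
  exact: (uv true).
exact: (uv false).
Qed.

(** Locally [U] has two generators [g] and [h]. Their E-minors and F-minors are killed by [D], so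
    some mixed minor is nonzero in the residue field. That minor, up to powers of [D], is the
    multiplier that moves the E-component of [u] into [U]. *)
Lemma zero_locus_split (A : comNzRingType) n (a b : A)
  (U : set 'rV[A]_(n + n)) :
    (4 < n)%N -> (exists a', a' * a = 1) -> (exists b', b' * b = 1) ->
    orthogonal_grassmannian 2 U -> clifford_image U (extremal_spinor n a b) ->
  forall u, U u -> U (row_mx (lsubmx u) 0).
Proof.
move=> n4 [a' a'a] [b' b'b] [gU qU] imU u Uu.
have sU : submodule U by case: gU.
pose I := [set d | U (d *: row_mx (lsubmx u) 0)].
suff : I 1 by rewrite /I /= scale1r.
apply: local_global => [|K f fsurj].
  split=> [|d x y Ix Iy]; rewrite /I /= ?scale0r; first by case: sU.
  by rewrite scalerDl -scalerA; apply: sU.2.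
have [D [G [fD UG fG genU]]] := local_basis fsurj gU.
set g := row 0 G; set h := row 1 G.
have gen w : U w -> exists x y, D *: w = x *: g + y *: h.
  case/genU => c ->; exists (c 0 0), (c 0 1).
  rewrite mulmx_sum_row big_ord_recl big_ord1.
  by rewrite (_ : lift ord0 0 = 1) //; apply/val_inj.
have pure c i j : D * vminor g h c i c j = 0.
  have [<-|ij] := eqVneq i j; first by rewrite /vminor; ring.
  have [S [e eS]] := clifford2_extremal a b g h c n4 ij.
  have := clifford_image_pair sU qU (UG 0) (UG 1) gen imU S.
  rewrite eS => {eS} e0; pose x := (-1) ^+ e * (if c then a' else b') : A.
  transitivity (x * (D * ((-1) ^+ e * (if c then a else b)
    * vminor g h c i c j))).
    have x1 : x * ((-1) ^+ e * (if c then a else b)) = 1.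
      by rewrite mulrACA -expr2 sqrr_sign mul1r; case: (c).
    by rewrite [RHS]mulrCA (mulrA x) x1 mul1r.
  by rewrite e0 mulr0.
have [i [j ij]] : exists i j, f (vminor g h true i false j) != 0.
  have [c [i [c' [j]]]] := row_free2_minor fG.
  rewrite -!map_row -/g -/h vminor_map.
  have fpure k l d : f (vminor g h d k d l) = 0.
    by apply/eqP; move/(congr1 f)/eqP: (pure d k l);
      rewrite rmorphM rmorph0 mulf_eq0 (negPf fD).
  case: c c' => [] []; rewrite ?fpure ?eqxx // => fij; first by exists i, j.
  by exists j, i; rewrite vminor_swap rmorphN oppr_eq0.
exists (D * (D * vminor g h true i false j));
  last by rewrite !rmorphM !mulf_neq0.
have [x [y e]] := gen u Uu.
(* The F-coordinates of [w] are F-minors times [D], hence zero, so [w] lies in the intersection of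
   [U] and E. The vanishing E-minors then make the E-component of [u] proportional to [w]. *)
pose w := (D * vcoord h false j) *: g + (- (D * vcoord g false j)) *: h.
have UZ c z : U z -> U (c *: z).
  by move=> Uz; rewrite -[_ *: z]addr0; apply: sU.2 => //; case: sU.
have Uw : U w by apply: sU.2; [apply: UG|apply: UZ; apply: UG].
rewrite /I /=.
suff -> : (D * (D * vminor g h true i false j)) *: row_mx (lsubmx u) 0
    = (x * vcoord g true i + y * vcoord h true i) *: w.
  exact: UZ.
apply: eq_vcoord => c l; rewrite /w !vcoordZ vcoordD vcoordZ vcoord_row_mx.
have el : D * vcoord u c l = x * vcoord g c l + y * vcoord h c l.
  by rewrite -vcoordZ e vcoordD vcoordZ.
case: c el => el; last first.
  rewrite mxE; transitivity ((x * vcoord g true i + y * vcoord h true i)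
      * (D * vminor g h false l false j)); first by rewrite pure !mulr0.
  by rewrite /vminor; ring.
rewrite -[lsubmx u 0 l]/(vcoord u true l) mulrAC el.
apply/eqP; rewrite -subr_eq0; apply/eqP.
rewrite -[RHS](mulr0 (x * vcoord g false j + y * vcoord h false j)).
by rewrite -(pure true i l) /vminor; ring.
Qed.

(** * Direct sums L + H *)

Definition direct_sum (A : comNzRingType) n (L H : set 'rV[A]_n) :
    set 'rV[A]_(n + n) :=
  [set u | L (lsubmx u) /\ H (rsubmx u)].

Lemma direct_sum_mx (A : comNzRingType) n (p q : 'M[A]_n) :
  direct_sum [set v | v *m p = v] [set v | v *m q = v]
    = [set v | v *m block_mx p 0 0 q = v].
Proof.
apply/seteqP; split=> v; rewrite -[v]hsubmxK /direct_sum /= row_mxKl row_mxKr;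
  rewrite mul_row_block !mulmx0 addr0 add0r.
  by case=> -> ->.
by case/eq_row_mx.
Qed.

Lemma block_idem (A : comNzRingType) n (p q : 'M[A]_n) :
  p *m p = p -> q *m q = q ->
  block_mx p 0 0 q *m block_mx p 0 0 q = block_mx p 0 0 q.
Proof. by move=> pp qq; rewrite mulmx_block !mulmx0 !mul0mx !addr0 !add0r pp qq.
Qed.

Lemma direct_sum_extend (A B : comNzRingType) (f : {rmorphism A -> B}) n r r'
    (L H : set 'rV[A]_n) :
  grassmannian r L -> grassmannian r' H ->
  extend f (direct_sum L H) = direct_sum (extend f L) (extend f H).
Proof.
move=> /grassmannian_mx[p [pp -> _]] /grassmannian_mx[q [qq -> _]].
rewrite direct_sum_mx !extend_mx ?block_idem // direct_sum_mx.
by rewrite map_block_mx !map_mx0.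
Qed.

Lemma direct_sum_grassmannian (A : comNzRingType) n r r' (L H : set 'rV[A]_n) :
  grassmannian r L -> grassmannian r' H -> grassmannian (r + r')
    (direct_sum L H).
Proof.
move=> /grassmannian_mx[p [pp -> rp]] /grassmannian_mx[q [qq -> rq]].
rewrite direct_sum_mx; apply: grassmannian_idem; first exact: block_idem.
by move=> K f; rewrite map_block_mx !map_mx0 rank_diag_block_mx rp rq.
Qed.

(** The projection onto [L] is nonzero over every residue field, so its entries generate the unit
    ideal. This serves in place of a generator when [L] is not free. *)
Lemma grassmannian_unimodular (A : comNzRingType) n r (L : set 'rV[A]_n) :
    grassmannian r.+1 L ->
  exists (p c : 'M[A]_n), (forall i, L (row i p)) /\
    \sum_i \sum_j p i j * c i j = 1.
Proof.
case/grassmannian_mx => p [pp LE rp].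
suff [c ci] : [set x | exists c : 'M[A]_n, x = \sum_i \sum_j p i j * c i j] 1.
  by exists p, c; split=> [i|//]; rewrite LE /= -row_mul pp.
apply: local_global => [|K f _].
  split=> [|a x y [c ->] [d ->]].
    by exists 0; rewrite big1 // => i _; rewrite big1 // => j _;
      rewrite mxE mulr0.
  exists (a *: c + d); rewrite mulr_sumr -big_split; apply: eq_bigr => i _ /=.
  rewrite mulr_sumr -big_split; apply: eq_bigr => j _ /=.
  by rewrite !mxE; ring.
have : map_mx f p != 0 by rewrite -mxrank_eq0 rp.
case/matrix0Pn => i [j]; rewrite mxE => pij; exists (p i j) => //.
exists (delta_mx i j); rewrite (bigD1 i) //= (bigD1 j) //= mxE !eqxx mulr1.
rewrite big1 ?addr0 => [|l /negPf lj]; last by rewrite mxE lj andbF mulr0.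
rewrite big1 ?addr0 // => l /negPf li; rewrite big1 // => m _.
by rewrite mxE li mulr0.
Qed.

(* For T empty, the vector of E with coordinates c; for T full, its image under
   the duality between E and the top but one exterior power. *)
Definition corner_spinor (A : comNzRingType) n (T : {set 'I_n})
  (c : 'I_n -> A) : spinor A n :=
  [ffun S => \sum_j if S == flip j T then ext_sign A j T * c j else 0].

Lemma odd_corner_spinor (A : comNzRingType) n (T : {set 'I_n}) (c : 'I_n -> A) :
  ~~ odd #|T| -> odd_spinor (corner_spinor T c).
Proof.
move=> eT S eS; rewrite ffunE big1 // => j _; case: eqP => // SE.
by move: eS; rewrite SE odd_flip eT.
Qed.

(** The hypothesis puts [v] in F when [T] is empty and in E when [T] is full. Such a [v] sends the
    neighbours of [T] back to [T] only, which leaves the pairing of [v] with [c]. *)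
Lemma clifford_corner (A : comNzRingType) n (v : 'rV[A]_(n + n))
    (T : {set 'I_n}) c :
    (forall i, vcoord v (i \notin T) i = 0) ->
  clifford v (corner_spinor T c)
    = [ffun S => if S == T then \sum_j vcoord v (j \in T) j * c j else 0].
Proof.
move=> v0; apply/ffunP => S; rewrite cliffordE ffunE.
case: eqP => [->|ST].
  apply: eq_bigr => i _; rewrite ffunE (bigD1 i) //= eqxx big1 ?addr0.
    by rewrite [ext_sign _ _ _ * _]mulrA ext_sign_sqr mul1r.
  move=> j /negPf ji; case: eqP => // /setP/(_ i);
    rewrite !in_flip eqxx eq_sym ji.
  by case: (i \in T).
apply: big1 => i _; have [iS|iS] := eqVneq (i \in S) (i \in T); last first.
  have -> : (i \in S) = (i \notin T) by case: (i \in S) (i \in T) iS => [] [].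
  by rewrite v0 mul0r.
rewrite ffunE big1 ?mulr0 // => j _; case: eqP => // e.
have ij : i = j.
  apply/eqP; move/setP/(_ i): e; rewrite !in_flip eqxx iS.
  by case: (i == j); case: (i \in T).
by case: ST; rewrite -[S](flipK i) e -ij flipK.
Qed.

(** The unit relations for [H] and [L] produce [a] at the empty set by contractions and [b] at the
    full set by wedge products. As [n] is even, the neighbours of the full set are odd. *)
Lemma extremal_clifford_image (A : comNzRingType) n (L H : set 'rV[A]_n)
  (a b : A) :
    ~~ odd n -> grassmannian 1 L -> grassmannian 1 H ->
  clifford_image (direct_sum L H) (extremal_spinor n a b).
Proof.
move=> en gL gH.
have [p [c [Lp pc]]] := grassmannian_unimodular gL.
have [q [d [Hq qd]]] := grassmannian_unimodular gH.
have [[L0 _] _ _] := gL; have [[H0 _] _ _] := gH.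
have -> : extremal_spinor n a b
    = \sum_i clifford (row_mx 0 (row i q))
      (corner_spinor finset.set0 (fun j => a * d i j))
      + (\sum_i clifford (row_mx (row i p) 0)
        (corner_spinor finset.setT (fun j => b * c i j))
      + 0).
  apply/ffunP => S; rewrite !ffunE addr0 !sum_ffunE.
  under eq_bigr => i _.
    rewrite clifford_corner => [|j]; last by rewrite vcoord_row_mx inE /= mxE.
    rewrite ffunE.
    under eq_bigr do rewrite vcoord_row_mx inE /= mxE mulrCA.
    over.
  under [X in _ + X]eq_bigr => i _.
    rewrite clifford_corner => [|j]; last by rewrite vcoord_row_mx inE /= mxE.
    rewrite ffunE.
    under eq_bigr do rewrite vcoord_row_mx inE /= mxE mulrCA.
    over.
  have [->|S0] := eqVneq S finset.set0; last first.
    rewrite big1 // add0r; case: eqP => ST; last by rewrite big1.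
    by under eq_bigr do rewrite -mulr_sumr; rewrite -mulr_sumr pc mulr1.
  rewrite [X in _ + X]big1 ?addr0 => [|i _].
    by under eq_bigr do rewrite -mulr_sumr; rewrite -mulr_sumr qd mulr1.
  by case: eqP => // /setP/(_ i); rewrite !inE.
apply: clifford_image_sum; last apply: clifford_image_sum;
  last exact: clifford_image0.
- by move=> i; rewrite /direct_sum /= row_mxKl row_mxKr.
- by move=> i; apply: odd_corner_spinor; rewrite cards0.
- by move=> i; rewrite /direct_sum /= row_mxKl row_mxKr.
- by move=> i; apply: odd_corner_spinor; rewrite cardsT card_ord.
Qed.

Lemma direct_sum_split (A : comNzRingType) n (U : set 'rV[A]_(n + n)) :
    submodule U -> (forall u, U u -> U (row_mx (lsubmx u) 0)) ->
  direct_sum [set l | U (row_mx l 0)] [set h | U (row_mx 0 h)] = U.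
Proof.
move=> sU splitU; have sub u v : U u -> U v -> U (u - v).
  by move=> Uu Uv; rewrite addrC -scaleN1r; apply: sU.2.
apply/seteqP; split=> u; rewrite -[u]hsubmxK /direct_sum /= row_mxKl row_mxKr.
  move=> [Ul Uh]; have := sU.2 1 _ _ Ul Uh.
  by rewrite scale1r add_row_mx addr0 add0r.
move=> Uu; have Ul := splitU _ Uu; rewrite row_mxKl in Ul; split=> //.
have -> : row_mx 0 (rsubmx u) = row_mx (lsubmx u) (rsubmx u) - row_mx (lsubmx u)
  0.
  by rewrite opp_row_mx add_row_mx subrr oppr0 addr0.
exact: sub.
Qed.

Lemma direct_sumK (A : comNzRingType) n (L H : set 'rV[A]_n) :
    submodule L -> submodule H ->
  ([set l | direct_sum L H (row_mx l 0)], [set h | direct_sum L H (row_mx 0 h)])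
    = (L, H).
Proof.
move=> [L0 _] [H0 _]; congr (_, _); apply/seteqP; split=> v;
  rewrite /direct_sum /= row_mxKl row_mxKr; by [case|split].
Qed.

(** If all E-components vanished over [K], nothing in the image could have a nonzero coefficient at
    the full set, against [f b != 0]. The empty set and [a] exclude the same for F. *)
Lemma extremal_not_in_half (A : comNzRingType) n (a b : A) (K : fieldType)
    (f : {rmorphism A -> K}) (U : set 'rV[A]_(n + n)) (c : bool) :
    (0 < n)%N -> f a != 0 -> f b != 0 ->
    clifford_image U (extremal_spinor n a b) ->
  exists u i, U u /\ f (vcoord u c i) != 0.
Proof.
move=> n0 fa fb imU; apply: contrapT => none.
have U0 u i : U u -> f (vcoord u c i) = 0.
  by move=> Uu; apply/eqP; apply: contrapT => /negP ui; apply: none;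
    exists u, i.
pose T : {set 'I_n} := if c then finset.setT else finset.set0.
have inT i : (i \in T) = c by rewrite {}/T; case: c {none U0}; rewrite inE.
have T0 y : clifford_image U y -> f (y T) = 0.
  elim/clifford_image_ind: y / => [|x y fx fy|v x Uv _].
  - by rewrite ffunE rmorph0.
  - by rewrite ffunE rmorphD fx fy addr0.
  rewrite cliffordE rmorph_sum big1 // => i _.
  by rewrite inT rmorphM U0 // mul0r.
have setT0 : (finset.setT == finset.set0 :> {set 'I_n}) = false.
  by apply/eqP => /setP/(_ (Ordinal n0)); rewrite !inE.
have := T0 _ imU; rewrite ffunE {inT T0}/T; case: c {none U0} => /eqP.
  by rewrite setT0 eqxx (negPf fb).
by rewrite eqxx (negPf fa).
Qed.

(** Because [U] splits, the diagonal blocks [p] and [q] of its projection are projections onto [L]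
    and [H]. Their ranks add up to 2 and neither is zero, so both are 1. Isotropy of [l + h] is the
    incidence relation. *)
Lemma zero_locus_flag (A : comNzRingType) n (a b : A) (U : set 'rV[A]_(n + n)) :
    (4 < n)%N -> (exists a', a' * a = 1) -> (exists b', b' * b = 1) ->
    orthogonal_grassmannian 2 U -> clifford_image U (extremal_spinor n a b) ->
  let L := [set l | U (row_mx l 0)] in let H := [set h | U (row_mx 0 h)] in
  flag_point (L, H) /\ direct_sum L H = U.
Proof.
move=> n4 ua ub oU imU L H; have [gU qU] := oU; have [sU _ _] := gU.
have splitU := zero_locus_split n4 ua ub oU imU.
have UE := direct_sum_split sU splitU; split=> //.
have unit_f (x : A) (K : fieldType) (f : {rmorphism A -> K}) :
    (exists x', x' * x = 1) -> f x != 0.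
  case=> x' /(congr1 f); rewrite rmorphM rmorph1 => fx.
  by apply: contra_eq_neq fx => ->; rewrite mulr0 eq_sym oner_eq0.
have [P [PP PE rP]] := grassmannian_mx gU.
pose p := ulsubmx P; pose q := drsubmx P.
have UP u : U (u *m P) by rewrite PE /= -mulmxA PP.
have fixP u : U u -> u *m P = u by rewrite PE.
have splitU' u : U u -> U (row_mx 0 (rsubmx u)).
  by rewrite -{1}UE => -[].
have lP l : lsubmx (row_mx l 0 *m P) = l *m p.
  by rewrite -{1}[P]submxK mul_row_block !mul0mx !addr0 row_mxKl.
have hP h : rsubmx (row_mx 0 h *m P) = h *m q.
  by rewrite -{1}[P]submxK mul_row_block !mul0mx !add0r row_mxKr.
have LE : L = [set l | l *m p = l].
  apply/seteqP; split=> [l /fixP Ll|l /= <-].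
    by rewrite /= -lP Ll row_mxKl.
  by rewrite /L /= -lP; apply: splitU.
have HE : H = [set h | h *m q = h].
  apply/seteqP; split=> [h /fixP Hh|h /= <-].
    by rewrite /= -hP Hh row_mxKr.
  by rewrite /H /= -hP; apply: splitU'.
have pp : p *m p = p.
  apply/row_matrixP => i; rewrite row_mul; have : L (row i p).
    by rewrite /L /= rowE -lP; apply: splitU.
  by rewrite LE.
have qq : q *m q = q.
  apply/row_matrixP => i; rewrite row_mul; have : H (row i q).
    by rewrite /H /= rowE -hP; apply: splitU'.
  by rewrite HE.
have rank2 (K : fieldType) (f : {rmorphism A -> K}) :
    (\rank (map_mx f p) + \rank (map_mx f q) = 2)%N.
  rewrite -rank_diag_block_mx -(rP K f).
  have -> : block_mx (map_mx f p) 0 0 (map_mx f q)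
    = map_mx f (block_mx p 0 0 q).
    by rewrite map_block_mx !map_mx0.
  have PE' : U = [set u | u *m block_mx p 0 0 q = u].
    by rewrite -UE -/L -/H LE HE direct_sum_mx.
  apply/eqP; rewrite eqn_leq; apply/andP; split; apply: mxrankS.
    apply/row_subP => i; rewrite -map_row; have : U (row i (block_mx p 0 0 q)).
      by rewrite PE' /= -row_mul block_idem.
    by move/fixP <-; rewrite map_mxM submxMl.
  apply/row_subP => i; rewrite -map_row; have : U (row i P) by rewrite rowE.
  by rewrite PE' /= => <-; rewrite map_mxM submxMl.
have p0 (K : fieldType) (f : {rmorphism A -> K}) : \rank (map_mx f p) != 0.
  have [|u [i [Uu]]] := extremal_not_in_half true _ (unit_f _ K f ua)
    (unit_f _ K f ub) imU; first by apply: leq_ltn_trans n4.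
  apply: contraNneq => /eqP; rewrite mxrank_eq0 => /eqP fp.
  move: Uu; rewrite -UE => -[]; rewrite -/L LE /= => e _.
  rewrite /vcoord -e; have := congr1 (fun X : 'rV_n => X 0 i)
    (map_mxM f (lsubmx u) p).
  by rewrite fp mulmx0 mxE [in RHS]mxE => ->.
have q0 (K : fieldType) (f : {rmorphism A -> K}) : \rank (map_mx f q) != 0.
  have [|u [i [Uu]]] := extremal_not_in_half false _ (unit_f _ K f ua)
    (unit_f _ K f ub) imU; first by apply: leq_ltn_trans n4.
  apply: contraNneq => /eqP; rewrite mxrank_eq0 => /eqP fq.
  move: Uu; rewrite -UE => -[_]; rewrite -/H HE /= => e.
  rewrite /vcoord -e; have := congr1 (fun X : 'rV_n => X 0 i)
    (map_mxM f (rsubmx u) q).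
  by rewrite fq mulmx0 mxE [in RHS]mxE => ->.
split=> /=.
- rewrite LE; apply: grassmannian_idem => // K f.
  by move: (rank2 K f) (p0 K f) (q0 K f); lia.
- rewrite HE; apply: grassmannian_idem => // K f.
  by move: (rank2 K f) (p0 K f) (q0 K f); lia.
move=> l h Ll Hh; apply/rowP => i; rewrite (ord1 i) !mxE.
have : U (row_mx l h) by rewrite -UE /direct_sum /= row_mxKl row_mxKr.
move/qU; rewrite quadE => qlh; rewrite -[RHS]qlh; apply: eq_bigr => j _.
by rewrite !vcoord_row_mx mxE.
Qed.

Lemma zero_locus_extremal_isomorphic (k : fieldType) n (a b : k) :
    (4 < n)%N -> ~~ odd n -> a != 0 -> b != 0 ->
  isomorphic (zero_locus 2 (extremal_spinor n a b)) (flag_variety k n).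
Proof.
move=> n4 en a0 b0.
have sE (A : comAlgType k) : scalar_spinor A (extremal_spinor n a b)
    = extremal_spinor n a%:A b%:A.
  by apply/ffunP => S; rewrite !ffunE; do 2 case: ifP => // _; rewrite scale0r.
have unitA (A : comAlgType k) (x : k) : x != 0 -> exists x' : A, x' * x%:A = 1.
  by move=> x0; exists (x^-1)%:A; rewrite -scalerAl mul1r scalerA mulVf //
    scale1r.
have flagU (A : comAlgType k) (U : Defs.point (zero_locus 2 (extremal_spinor n a
  b)) A) :
    let L := [set l | sval U (row_mx l 0)] in
    let H := [set h | sval U (row_mx 0 h)] in
    flag_point (L, H) /\ direct_sum L H = sval U.
  have [oU imU] := svalP U; rewrite sE in imU.
  by apply: zero_locus_flag imU => //; apply: unitA.
have sumU (A : comAlgType k) (x : Defs.point (flag_variety k n) A) :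
    zero_locus_point 2 (extremal_spinor n a b)
      (direct_sum (sval x).1 (sval x).2).
  case: x => -[L H] [/= gL gH LH]; split; last first.
    by rewrite sE; apply: extremal_clifford_image.
  split; first exact: (direct_sum_grassmannian gL gH).
  move=> u [Lu Hu]; have := LH _ _ Lu Hu => /matrixP/(_ 0 0).
  rewrite !mxE => <-; apply: eq_bigr => i _; by rewrite !mxE.
pose phi A U : Defs.point (flag_variety k n) A := exist _ _ (flagU A U).1.
exists phi; split=> [A|A B f U].
  exists (fun x => exist _ _ (sumU A x)) => [U|x].
    by case: U (flagU A U) => U zU [? UE] /=; apply: eq_exist.
  case: x (sumU A x) => -[L H] xLH zU; apply: eq_exist => /=.
  by have [/= [sL _ _] [sH _ _] _] := xLH; apply: direct_sumK.
apply: eq_exist => /=; have [[gL gH _] UE] := flagU A U.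
rewrite /= in gL gH; rewrite -{1 2}UE (direct_sum_extend f gL gH).
by apply: direct_sumK; apply: span_submodule.
Qed.

(** * Transvections *)

Lemma isomorphic_trans (k : fieldType) (X Y Z : alg_functor k) :
  isomorphic X Y -> isomorphic Y Z -> isomorphic X Z.
Proof.
move=> [phi [bphi nphi]] [psi [bpsi npsi]]; exists (fun A => psi A \o phi A).
by split=> [A|A B f x /=]; [apply: bij_comp|rewrite nphi npsi].
Qed.

Lemma conj_idem (A : comNzRingType) n (G G' p : 'M[A]_n) :
  G *m G' = 1%:M -> p *m p = p ->
  (G' *m p *m G) *m (G' *m p *m G) = G' *m p *m G.
Proof.
move=> GG' pp.
by rewrite !mulmxA -[_ *m G *m G']mulmxA GG' mulmx1 -(mulmxA G') pp.
Qed.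

Lemma preimage_mx (A : comNzRingType) n (G G' p : 'M[A]_n) :
    G *m G' = 1%:M -> G' *m G = 1%:M ->
  [set v : 'rV_n | (v *m G') *m p = v *m G'] = [set v | v *m (G' *m p *m G)
    = v].
Proof.
move=> GG' G'G; apply/seteqP; split=> v /=; rewrite !mulmxA.
  by move=> ->; rewrite -mulmxA G'G mulmx1.
by move=> e; rewrite -[in RHS]e -[RHS]mulmxA GG' mulmx1.
Qed.

Lemma grassmannian_preimage (A : comNzRingType) n r (G G' : 'M[A]_n) U :
    G *m G' = 1%:M -> G' *m G = 1%:M ->
  grassmannian r U -> grassmannian r [set v | U (v *m G')].
Proof.
move=> GG' G'G /grassmannian_mx[p [pp -> rp]] /=;
  rewrite (preimage_mx p GG' G'G).
apply: grassmannian_idem; first exact: conj_idem.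
move=> K f; rewrite !map_mxM mxrankMfree; last first.
  by apply/row_freeP; exists (map_mx f G'); rewrite -map_mxM GG' map_mx1.
rewrite eqmxMfull ?rp //; apply/row_fullP; exists (map_mx f G).
by rewrite -map_mxM GG' map_mx1.
Qed.

Lemma extend_preimage (A B : comNzRingType) (f : {rmorphism A -> B}) n r
    (G G' : 'M[A]_n) U : G *m G' = 1%:M -> G' *m G = 1%:M ->
  grassmannian r U ->
  extend f [set v | U (v *m G')] = [set v | extend f U (v *m map_mx f G')].
Proof.
move=> GG' G'G /grassmannian_mx[p [pp -> _]] /=;
  rewrite (preimage_mx p GG' G'G).
have fGG' : map_mx f G *m map_mx f G' = 1%:M by rewrite -map_mxM GG' map_mx1.
have fG'G : map_mx f G' *m map_mx f G = 1%:M by rewrite -map_mxM G'G map_mx1.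
by rewrite !extend_mx ?conj_idem // !map_mxM -(preimage_mx (map_mx f p)
  fGG' fG'G).
Qed.

(** The translate of [U] by [G] is written as the preimage under the inverse [G']. Naturality holds
    because [G] has entries in [k]. *)
Lemma zero_locus_isomorphic (k : fieldType) n r (s s' : spinor k n)
    (G G' : 'M[k]_(n + n)) : G *m G' = 1%:M -> G' *m G = 1%:M ->
    (forall (A : comAlgType k) (U : set 'rV[A]_(n + n)), zero_locus_point r s U
      ->
       zero_locus_point r s' [set v | U (v *m map_mx (in_alg A) G')]) ->
    (forall (A : comAlgType k) (U : set 'rV[A]_(n + n)), zero_locus_point r s' U
      ->
       zero_locus_point r s [set v | U (v *m map_mx (in_alg A) G)]) ->
  isomorphic (zero_locus r s) (zero_locus r s').
Proof.
move=> GG' G'G ss' s's.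
have GG'A (A : comAlgType k) : map_mx (in_alg A) G *m map_mx (in_alg A)
  G' = 1%:M.
  by rewrite -map_mxM GG' map_mx1.
have G'GA (A : comAlgType k) : map_mx (in_alg A) G' *m map_mx (in_alg A)
  G = 1%:M.
  by rewrite -map_mxM G'G map_mx1.
exists (fun A U => exist _ _ (ss' A _ (svalP U)));
  split=> [A|A B f [U [[gU qU] iU]]].
  exists (fun U => exist _ _ (s's A _ (svalP U))) => -[U zU];
    apply: eq_exist => /=;
    apply/seteqP; split=> v /=; by rewrite -mulmxA ?GG'A ?G'GA mulmx1.
apply: eq_exist => /=; rewrite (extend_preimage _ (GG'A A) (G'GA A) gU).
have -> // : map_mx f (map_mx (in_alg A) G') = map_mx (in_alg B) G'.
by apply/matrixP => i j; rewrite !mxE /= rmorph_alg.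
Qed.

Lemma scale_zero_locus_isomorphic (k : fieldType) n r (c : k) (s : spinor k n) :
  c != 0 -> isomorphic (zero_locus r s) (zero_locus r (spinor_scale c s)).
Proof.
move=> c0; have scale_point (A : comAlgType k) (U : set 'rV[A]_(n + n)) d t :
    zero_locus_point r t U ->
    zero_locus_point r (spinor_scale d t) [set v | U (v *m map_mx (in_alg A)
      1%:M)].
  move=> [oU imU]; rewrite map_mx1.
  have -> : [set v : 'rV_(n + n) | U (v *m 1%:M)] = U.
    by apply/seteqP; split=> v /=; rewrite mulmx1.
  split=> //; have -> : scalar_spinor A (spinor_scale d t)
      = spinor_scale d%:A (scalar_spinor A t).
    by apply/ffunP => S; rewrite !ffunE -scalerAl mul1r scalerA.
  apply: clifford_image_morph imU => [|x y|v x Uv ox].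
  - by apply/ffunP => S; rewrite !ffunE mulr0.
  - by apply/ffunP => S; rewrite !ffunE mulrDr.
  - exists v, (spinor_scale d%:A x); split=> [//|S eS|];
    last by rewrite cliffordZr.
    by rewrite ffunE ox ?mulr0.
apply: (@zero_locus_isomorphic _ _ _ _ _ 1%:M 1%:M); rewrite ?mulmx1 // => A U.
  exact: scale_point.
have cK : spinor_scale c^-1 (spinor_scale c s) = s.
  by apply/ffunP => S; rewrite !ffunE mulrA mulVf ?mul1r.
by move/(scale_point _ _ c^-1); rewrite cK.
Qed.

(** The column that represents the linear form [polar a]. *)
Definition swap_halves (A : comNzRingType)
  n (a : 'rV[A]_(n + n)) : 'cV[A]_(n + n) :=
  (row_mx (rsubmx a) (lsubmx a))^T.

Lemma mul_swap_halves (A : comNzRingType) n (a v : 'rV[A]_(n + n)) :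
  v *m swap_halves a = (polar a v)%:M.
Proof.
apply/rowP => j; rewrite [j]ord1 -[v]hsubmxK /swap_halves tr_row_mx mul_row_col
  !mxE mulr1n.
rewrite -big_split; apply: eq_bigr => i _ /=.
by rewrite !vcoord_row_mx !mxE /vcoord !mxE; ring.
Qed.

(* Conjugation of vectors by 1 + ab in the Clifford algebra. *)
Definition transvection (A : comNzRingType)
  n (a b : 'rV[A]_(n + n)) : 'M[A]_(n + n) :=
  1%:M + swap_halves b *m a - swap_halves a *m b.

Lemma mul_transvection (A : comNzRingType) n (a b v : 'rV[A]_(n + n)) :
  v *m transvection a b = v + polar b v *: a - polar a v *: b.
Proof.
by rewrite mulmxBr mulmxDr mulmx1 !mulmxA !mul_swap_halves !mul_scalar_mx.
Qed.

Definition spinor_transvection (A : comNzRingType) n (a b : 'rV[A]_(n + n))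
    (x : spinor A n) : spinor A n :=
  x + clifford a (clifford b x).

(** Equivariance under [1 + ab]. Moving [v] past [b] and [a] produces the polar terms of the
    transvection, and products with a repeated [a] or [b] vanish. *)
Lemma clifford_transvection (A : comNzRingType) n (a b v : 'rV[A]_(n + n)) x :
    quad a = 0 -> quad b = 0 -> polar a b = 0 ->
  clifford (v *m transvection a b) (spinor_transvection a b x)
    = spinor_transvection a b (clifford v x).
Proof.
move=> qa qb ab; have [aba abb] := clifford_isotropic_pair x qa qb ab.
have sq (w : 'rV[A]_(n + n)) y : quad w = 0 -> clifford w (clifford w y)
  = 0 :> spinor A n.
  by move=> qw; apply/ffunP => S; rewrite clifford_quad qw mul0r ffunE.
have anti (w w' : 'rV[A]_(n + n)) y : clifford w (clifford w' y)
    = spinor_scale (polar w w') y + spinor_scale (-1)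
      (clifford w' (clifford w y)).
  apply/ffunP => S; rewrite [RHS]ffunE [in RHS]ffunE [X in _ + X]ffunE mulN1r.
  by rewrite -clifford_polar addrK.
have bab : clifford b (clifford a (clifford b x)) = 0.
  rewrite anti polarC ab sq // clifford0r; apply/ffunP => S.
  by rewrite !ffunE mul0r mulr0 addr0.
rewrite mul_transvection /spinor_transvection -scaleNr -addrA !cliffordDl
  !cliffordZl.
rewrite !cliffordDr bab sq // addr0 (anti b v)
  cliffordDr !cliffordZr (anti a v).
move: (clifford v (clifford a (clifford b x))) (clifford v x).
move: (clifford a x) (clifford b x).
by move=> x1 x2 x3 x4; apply/ffunP => S; rewrite !ffunE; ring.
Qed.

Lemma polarDr (A : comNzRingType) n a (u v w : 'rV[A]_(n + n)) :
  polar w (a *: u + v) = a * polar w u + polar w v.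
Proof.
rewrite mulr_sumr -big_split; apply: eq_bigr => i _ /=.
by rewrite !vcoordD; ring.
Qed.

Lemma polarNl (A : comNzRingType) n (u v : 'rV[A]_(n + n)) :
  polar (- u) v = - polar u v.
Proof.
by rewrite -sumrN; apply: eq_bigr => i _; rewrite -scaleN1r !vcoordZ; ring.
Qed.

Lemma polar_self (A : comNzRingType) n (u : 'rV[A]_(n + n)) : polar u u = quad u
  *+ 2.
Proof.
by rewrite quadE -sumrMnl; apply: eq_bigr => i _; rewrite mulr2n.
Qed.

Lemma quadN (A : comNzRingType) n (u : 'rV[A]_(n + n)) : quad (- u) = quad u.
Proof.
by rewrite !quadE; apply: eq_bigr => i _; rewrite -scaleN1r !vcoordZ; ring.
Qed.

Section Transvection.
Variables (A : comNzRingType) (n : nat) (a b : 'rV[A]_(n + n)).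
Hypotheses (qa : quad a = 0) (qb : quad b = 0) (ab : polar a b = 0).

Lemma transvectionE (v : 'rV[A]_(n + n)) :
  v *m transvection a b = polar b v *: a + (- polar a v *: b + v).
Proof. by rewrite mul_transvection scaleNr -addrA addrCA (addrC v). Qed.

Lemma transvectionK : transvection a b *m transvection a (- b) = 1%:M.
Proof.
apply/row_matrixP => i; rewrite row1 rowE mulmxA; move: (delta_mx 0 i) => v.
rewrite mul_transvection polarNl transvectionE !polarDr !polar_self qa qb.
rewrite (polarC b a) ab mul0rn !mulr0 !add0r; apply/rowP => j; rewrite !mxE;
  ring.
Qed.

Lemma quad_transvection v : quad (v *m transvection a b) = quad v.
Proof.
rewrite transvectionE !quadD !polarDr qa qb ab (polarC b v) (polarC a v); ring.
Qed.

Lemma spinor_transvectionK :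
  cancel (spinor_transvection a b) (spinor_transvection a (- b)).
Proof.
move=> x; rewrite /spinor_transvection -scaleN1r !cliffordZl !cliffordZr
  !cliffordDr.
have [-> _] := clifford_isotropic_pair (clifford b x) qa qb ab.
move: (clifford a (clifford b x)) => y.
by apply/ffunP => S; rewrite !ffunE; ring.
Qed.

End Transvection.

Lemma clifford_parity (A : comNzRingType) n (p : bool) (v : 'rV[A]_(n + n))
    (x : spinor A n) :
    (forall S : {set 'I_n}, odd #|S| = p -> x S = 0) ->
  forall S : {set 'I_n}, odd #|S| = ~~ p -> clifford v x S = 0.
Proof.
move=> x0 S Sp; rewrite cliffordE big1 // => i _.
by rewrite x0 ?mulr0 // odd_flip Sp negbK.
Qed.

Lemma odd_spinor_transvection (A : comNzRingType) n (a b : 'rV[A]_(n + n)) x :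
  odd_spinor x -> odd_spinor (spinor_transvection a b x).
Proof.
move=> ox S eS; rewrite ffunE ox // add0r.
apply: (@clifford_parity _ _ true) => [T oT|]; last exact: negPf.
by apply: (@clifford_parity _ _ false) => [R /negbT /ox|].
Qed.

Section TransvectionIsomorphism.
Variables (k : fieldType) (n r : nat).
Implicit Types (a b : 'rV[k]_(n + n)) (s : spinor k n).

Lemma quad_map (A B : comNzRingType) (f : {rmorphism A -> B})
  (u : 'rV[A]_(n + n)) :
  quad (map_mx f u) = f (quad u).
Proof.
by rewrite !quadE rmorph_sum; apply: eq_bigr => i _;
  rewrite !vcoord_map rmorphM.
Qed.

Lemma polar_map (A B : comNzRingType) (f : {rmorphism A -> B})
  (u v : 'rV[A]_(n + n)) :
  polar (map_mx f u) (map_mx f v) = f (polar u v).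
Proof.
rewrite rmorph_sum; apply: eq_bigr => i _.
by rewrite !vcoord_map rmorphD !rmorphM.
Qed.

Lemma transvection_map (A B : comNzRingType) (f : {rmorphism A -> B})
    (a b : 'rV[A]_(n + n)) :
  map_mx f (transvection a b) = transvection (map_mx f a) (map_mx f b).
Proof.
rewrite /transvection /swap_halves !map_mxD map_mx1 raddfN /= !map_mxM
  -!map_trmx.
by rewrite !map_row_mx !map_lsubmx !map_rsubmx.
Qed.

Lemma scalar_spinor_transvection (A : comAlgType k) a b s :
  scalar_spinor A (spinor_transvection a b s)
    = spinor_transvection (map_mx (in_alg A) a) (map_mx (in_alg A) b)
      (scalar_spinor A s).
Proof.
have mapE u t : clifford (map_mx (in_alg A) u) (scalar_spinor A t)
    = scalar_spinor A (clifford u t).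
  by rewrite -[scalar_spinor A t]/[ffun S => in_alg A (t S)] clifford_map.
rewrite /spinor_transvection !mapE; apply/ffunP => S.
by rewrite !ffunE scalerDl.
Qed.

Lemma zero_locus_transvection (A : comAlgType k)
  a b s (U : set 'rV[A]_(n + n)) :
    quad a = 0 -> quad b = 0 -> polar a b = 0 ->
    zero_locus_point r s U ->
  zero_locus_point r (spinor_transvection a b s)
    [set v | U (v *m map_mx (in_alg A) (transvection a (- b)))].
Proof.
move=> qa qb ab [[gU qU] imU].
have ab' : polar a (- b) = 0 by rewrite polarC polarNl polarC ab oppr0.
have qb' : quad (- b) = 0 by rewrite quadN.
have TK : transvection a b *m transvection a (- b)
  = 1%:M by apply: transvectionK.
have T'K : transvection a (- b) *m transvection a b = 1%:M.
  by rewrite -{2}[b]opprK; apply: transvectionK.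
have mapq (u : 'rV[k]_(n + n)) : quad u = 0 -> quad (map_mx (in_alg A) u) = 0.
  by move=> qu; rewrite quad_map qu rmorph0.
have mapp (u v : 'rV[k]_(n + n)) :
    polar u v = 0 -> polar (map_mx (in_alg A) u) (map_mx (in_alg A) v) = 0.
  by move=> uv; rewrite polar_map uv rmorph0.
split; first split.
- by apply: (grassmannian_preimage (G := map_mx (in_alg A) (transvection a b)))
  gU;
    rewrite -map_mxM ?TK ?T'K map_mx1.
- by move=> v /= /qU; rewrite transvection_map quad_transvection //; auto.
rewrite scalar_spinor_transvection; apply: clifford_image_morph imU => [|x y|v x
  Uv ox].
- by rewrite /spinor_transvection !clifford0r addr0.
- by rewrite /spinor_transvection !cliffordDr addrACA.
exists (v *m transvection (map_mx (in_alg A) a) (map_mx (in_alg A) b)).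
exists (spinor_transvection (map_mx (in_alg A) a) (map_mx (in_alg A) b) x);
  split.
- by rewrite /= -transvection_map -mulmxA -map_mxM TK map_mx1 mulmx1.
- exact: odd_spinor_transvection.
- by rewrite clifford_transvection //; auto.
Qed.

Lemma transvection_isomorphic a b s :
    quad a = 0 -> quad b = 0 -> polar a b = 0 ->
  isomorphic (zero_locus r s) (zero_locus r (spinor_transvection a b s)).
Proof.
move=> qa qb ab.
have ab' : polar a (- b) = 0 by rewrite polarC polarNl polarC ab oppr0.
have qb' : quad (- b) = 0 by rewrite quadN.
apply: (@zero_locus_isomorphic _ _ _ _ _ (transvection a b)
  (transvection a (- b))).
- exact: transvectionK.
- by rewrite -{2}[b]opprK; apply: transvectionK.
- by move=> A U; apply: zero_locus_transvection.
- move=> A U /(zero_locus_transvection qa qb' ab').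
  by rewrite opprK spinor_transvectionK.
Qed.

End TransvectionIsomorphism.

(** * Genericity *)

Section Genericity.
Variables (k : fieldType) (I : finType).
Implicit Types (f g : {ffun I -> k} -> k) (D : set {ffun I -> k}).

(** Polynomial functions are described by their construction, so that closure under substitution is
    an induction. *)
Inductive polyfun : ({ffun I -> k} -> k) -> Prop :=
| polyfun_coord i : polyfun (fun x => x i)
| polyfun_const c : polyfun (fun=> c)
| polyfun_add f g : polyfun f -> polyfun g -> polyfun (fun x => f x + g x)
| polyfun_mul f g : polyfun f -> polyfun g -> polyfun (fun x => f x * g x).

Lemma polyfun_mpoly f : polyfun f ->
  exists p : mpoly.mpoly #|I| k,
    forall x, f x = mpoly.meval (fun i => x (enum_val i)) p.
Proof.
elim=> [i|c|f' g _ [p pE] _ [q qE]|f' g _ [p pE] _ [q qE]].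
- exists (mpoly.mpolyX k (mpoly.mnm1 (enum_rank i))) => x.
  by rewrite mpoly.mevalXU enum_rankK.
- by exists (mpoly.mpolyC _ c) => x; rewrite mpoly.mevalC.
- by eexists => x; rewrite pE qE; apply/esym/mpoly.mevalD.
- by eexists => x; rewrite pE qE; apply/esym/mpoly.mevalM.
Qed.

Lemma polyfun_comp f (h : {ffun I -> k} -> {ffun I -> k}) :
  polyfun f -> (forall i, polyfun (fun x => h x i)) -> polyfun (f \o h).
Proof.
move=> pf ph; elim: pf => [i|c|f' g _ IHf _ IHg|f' g _ IHf _ IHg].
- exact: ph.
- exact: (polyfun_const c).
- exact: polyfun_add IHf IHg.
- exact: polyfun_mul IHf IHg.
Qed.

(** The point [x0] certifies that the open set is nonempty. Each reduction step fixes [x0], so the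
    open sets of successive steps all contain it. *)
Definition generic_near (x0 : {ffun I -> k})
  D (Q : {ffun I -> k} -> Prop) : Prop :=
  exists f, [/\ polyfun f, f x0 != 0 & forall x, D x -> f x != 0 -> Q x].

Lemma generic_near_for_general x0 D Q :
  D x0 -> generic_near x0 D Q -> for_general D Q.
Proof.
move=> Dx0 [f [pf fx0 fQ]]; have [p pE] := polyfun_mpoly pf.
exists [set x | f x = 0]; split=> [|DZ|x Dx /eqP fx]; last exact: fQ.
- exists [set p]; apply/seteqP; split=> x /= => [fx _ ->|/(_ _ erefl)];
  by rewrite -pE.
- by move/eqP: fx0; apply; apply: DZ.
Qed.

Lemma generic_near_step x0 D D' Q (h : {ffun I -> k} -> {ffun I -> k}) d :
    (forall i, polyfun (fun x => h x i)) -> polyfun d ->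
    h x0 = x0 -> d x0 != 0 ->
    (forall x, D x -> D' (h x)) ->
    (forall x, D x -> d x != 0 -> Q (h x) -> Q x) ->
  generic_near x0 D' Q -> generic_near x0 D Q.
Proof.
move=> ph pd hx0 dx0 DD' hQ [f [pf fx0 fQ]].
exists (fun x => d x * (f \o h) x); split.
- by apply: polyfun_mul => //; apply: polyfun_comp.
- by rewrite /= hx0 mulf_neq0.
- move=> x Dx; rewrite mulf_eq0 negb_or => /andP[dx fhx].
  by apply: hQ => //; apply: fQ => //; apply: DD'.
Qed.

End Genericity.

(** * Transvections along basis vectors, and elimination of one coefficient *)

Section BasisTransvection.
Variables (k : fieldType) (n : nat).

Definition basis_vec (c : bool) (i : 'I_n) : 'rV[k]_(n + n) :=
  if c then row_mx (delta_mx 0 i) 0 else row_mx 0 (delta_mx 0 i).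

Lemma vcoord_basis_vec c i b j :
  vcoord (basis_vec c i) b j = ((b == c) && (j == i))%:R.
Proof.
by rewrite /basis_vec; case: c; rewrite vcoord_row_mx; case: b;
  rewrite !mxE ?eqxx.
Qed.

Lemma quad_basis_vec c i : quad (basis_vec c i) = 0.
Proof.
rewrite quadE big1 // => j _; rewrite !vcoord_basis_vec.
by case: c; rewrite /= ?mul0r ?mulr0.
Qed.

Lemma polar_basis_vec c i d j : i != j ->
  polar (basis_vec c i) (basis_vec d j) = 0.
Proof.
move=> ij; rewrite /polar big1 // => l _; rewrite !vcoord_basis_vec.
have [->|li] := eqVneq l i; last by rewrite !andbF mul0r mulr0 addr0.
by rewrite (negPf ij) !andbF mul0r mulr0 addr0.
Qed.

Lemma clifford_basis_vec c i (x : spinor k n) S :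
  clifford (basis_vec c i) x S
    = if (i \in S) == c then ext_sign k i S * x (flip i S) else 0.
Proof.
rewrite cliffordE (bigD1 i) //= big1 ?addr0.
  by rewrite vcoord_basis_vec eqxx andbT; case: eqP; rewrite ?mul1r ?mul0r.
by move=> j ji; rewrite vcoord_basis_vec (negPf ji) andbF mul0r.
Qed.

Definition pair_sign (i j : 'I_n) S : k :=
  ext_sign k i S * ext_sign k j (flip i S).

Lemma pair_sign_sqr i j S : pair_sign i j S * pair_sign i j S = 1.
Proof. by rewrite /pair_sign mulrACA !ext_sign_sqr mulr1. Qed.

Lemma basis_transvectionE t c i d j (x : spinor k n) S : i != j ->
  spinor_transvection (t *: basis_vec c i) (basis_vec d j) x S
    = x S + t * (if ((i \in S) == c) && ((j \in S) == d)
                 then pair_sign i j S * x (flip j (flip i S)) else 0).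
Proof.
move=> ij; rewrite /spinor_transvection cliffordZl 2!ffunE !clifford_basis_vec.
rewrite in_flip (eq_sym j i) (negPf ij) /=; congr (_ + _ * _).
by case: eqP => //= _; case: eqP => _; rewrite ?mulr0 // mulrA.
Qed.

Lemma basis_transvection_isomorphic r t c i d j (x : spinor k n) : i != j ->
  isomorphic (zero_locus r x)
    (zero_locus r (spinor_transvection (t *: basis_vec c i) (basis_vec d j) x)).
Proof.
move=> ij; apply: transvection_isomorphic; last 1 first.
- by rewrite polarC -[t *: _]addr0 polarDr polarC polar_basis_vec //;
  rewrite mulr0 add0r /polar big1 // => l _;
  rewrite -(scale0r 0) !vcoordZ !mul0r mulr0 addr0.
- by rewrite quadE big1 // => l _; rewrite !vcoordZ !vcoord_basis_vec; case: c;
  rewrite /= ?(mulr0, mul0r).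
- exact: quad_basis_vec.
Qed.

(* With pivot S0, the transvection of parameter -+ x S1 / x S0 kills the
   coefficient at S1; it is scaled by x S0 to become polynomial in x. *)
Definition kill (S0 : {set 'I_n}) c i d j (x : spinor k n) : spinor k n :=
  let S1 := flip i (flip j S0) in
  [ffun S => x S0 * x S
     - pair_sign i j S1 * x S1 * (if ((i \in S) == c) && ((j \in S) == d)
                 then pair_sign i j S * x (flip j (flip i S)) else 0)].

Lemma kill_scale S0 c i d j (x : spinor k n) : i != j -> x S0 != 0 ->
  let S1 := flip i (flip j S0) in
  kill S0 c i d j x = spinor_scale (x S0)
    (spinor_transvection ((- (pair_sign i j S1 * x S1 / x S0)) *: basis_vec c i)
       (basis_vec d j) x).
Proof.
move=> ij x0 S1; apply/ffunP => S; rewrite ffunE [RHS]ffunE basis_transvectionE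
  // -/S1.
by rewrite mulrDr mulNr mulrN mulrA [x S0 * (_ / _)]mulrC divfK.
Qed.

(** [K] lists the coefficients that are already zero. Where the transvection acts, it adds to the
    coefficient at [S] a multiple of the one at [flip j (flip i S)]; the closure condition on [K]
    therefore preserves earlier zeros. *)
Lemma generic_kill r (Y : alg_functor k) (x0 : spinor k n)
  (K K' : set {set 'I_n}) S0 c i d j :
    let S1 := flip i (flip j S0) in
    i != j -> (i \in S1) = c -> (j \in S1) = d -> x0 S0 = 1 -> x0 S1 = 0 ->
    K' `<=` K `|` [set S1] ->
    (forall S, K S -> (i \in S) = c -> (j \in S) = d -> S != S1 ->
       K (flip j (flip i S))) ->
    generic_near x0 [set x | forall S, K' S -> x S = 0]
      (fun x => isomorphic (zero_locus r x) Y) ->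
  generic_near x0 [set x | forall S, K S -> x S = 0]
      (fun x => isomorphic (zero_locus r x) Y).
Proof.
move=> S1 ij iS1 jS1 x00 x01 KK' KK.
have fS1 : flip j (flip i S1) = S0 by rewrite /S1 !flipK.
apply: (generic_near_step (h := kill S0 c i d j) (d := fun x => x S0)).
- move=> S; rewrite (_ : (fun x : spinor k n => _)
    = fun x : spinor k n => x S0 * x S + (- (pair_sign i j S1 *
        (if ((i \in S) == c) && ((j \in S) == d) then pair_sign i j S else 0)))
        * (x S1 * x (flip j (flip i S)))).
    by repeat constructor.
  by apply/funext => x; rewrite ffunE -/S1; case: ifP => _; ring.
- exact: polyfun_coord.
- apply/ffunP => S; rewrite ffunE -/S1 x00 x01 mulr0 mul0r subr0 mul1r //.
- by rewrite x00 oner_eq0.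
- move=> x /= xK S /KK' KS; rewrite ffunE -/S1; have [->|SS1] := eqVneq S S1.
    rewrite iS1 jS1 !eqxx fS1; apply/eqP; rewrite subr_eq0 mulrC; apply/eqP.
    by rewrite mulrACA pair_sign_sqr mul1r.
  have {}KS : K S by case: KS => // SE; rewrite SE eqxx in SS1.
  rewrite (xK S KS) mulr0; case: ifP => [/andP[/eqP iS /eqP jS]|_].
    by rewrite (xK _ (KK S KS iS jS SS1)) !mulr0 subr0.
  by rewrite mulr0 subr0.
- move=> x _ xS0 iso; apply: isomorphic_trans iso; rewrite kill_scale //.
  apply: isomorphic_trans (scale_zero_locus_isomorphic _ _ xS0).
  exact: basis_transvection_isomorphic.
Qed.

End BasisTransvection.

(** * Reduction to five coefficients *)

(** Subsets become Boolean lists so that [vm_compute] can check the whole elimination. *)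
Definition code (S : {set 'I_6}) : seq bool := [seq i \in S | i <- enum 'I_6].

Definition decode (s : seq bool) : {set 'I_6} := [set i : 'I_6 | nth false s i].

Definition flip_code (i : nat) (s : seq bool) : seq bool :=
  set_nth false s i (~~ nth false s i).

Fixpoint all_codes (m : nat) : seq (seq bool) :=
  if m is m'.+1 then
    [seq true :: s | s <- all_codes m'] ++ [seq false :: s | s <- all_codes m']
  else [:: [::]].

Lemma mem_all_codes s : s \in all_codes (size s).
Proof.
elim: s => [|b s IH] //=; rewrite mem_cat; apply/orP.
by case: b; [left|right]; apply: map_f.
Qed.

Lemma size_code S : size (code S) = 6.
Proof. by rewrite size_map size_enum_ord. Qed.

Lemma nth_code (S : {set 'I_6}) (i : 'I_6) : nth false (code S) i = (i \in S).
Proof. by rewrite (nth_map i) ?size_enum_ord // nth_ord_enum. Qed.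

Lemma codeK S : decode (code S) = S.
Proof. by apply/setP => i; rewrite inE nth_code. Qed.

Lemma decodeK s : size s = 6 -> code (decode s) = s.
Proof.
move=> s6; apply: (@eq_from_nth _ false); rewrite size_code ?s6 // => i i6.
by rewrite (nth_code _ (Ordinal i6)) inE.
Qed.

Lemma code_flip (i : 'I_6) S : code (flip i S) = flip_code i (code S).
Proof.
apply: (@eq_from_nth _ false); rewrite size_code ?size_set_nth ?size_code.
  by case: i => -[|[|[|[|[|[|]]]]]].
move=> j j6; rewrite (nth_code _ (Ordinal j6)) in_flip nth_set_nth /=.
rewrite -(nth_code S (Ordinal j6)) -val_eqE /=.
by have [->|ji] := eqVneq j (i : nat).
Qed.

Lemma odd_code S : odd (count id (code S)) = odd #|S|.
Proof.
by rewrite /code count_map cardE enumT /enum_mem size_filter; congr odd;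
  apply: eq_count.
Qed.

(* (c, i, d, j, s) kills the coefficient of the set reached from the pivot s by
   changing the membership of i and j; c and d are the new memberships. *)
Definition kill_step : Type := bool * nat * bool * nat * seq bool.

Definition step_target (st : kill_step) : seq bool :=
  let: (c, i, d, j, s) := st in flip_code i (flip_code j s).

Definition pivots : seq (seq bool) :=
  [:: nseq 6 false; [:: true; true; true; true; false; false];
      [:: true; true; false; false; true; true];
      [:: false; false; true; true; true; true]].

(** The decidable form of the hypotheses of [generic_kill] at [base_spinor], which is 1 on the
    pivots and 0 elsewhere. *)
Definition valid_step (K : seq (seq bool)) (st : kill_step) : bool :=
  let: (c, i, d, j, s) := st in let s1 := step_target st in
  [&& i != j, (i < 6)%N, (j < 6)%N, nth false s1 i == c, nth false s1 j == d,
    s \in pivots, s1 \notin pivots &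
    all (fun t => [|| nth false t i != c, nth false t j != d, t == s1 |
                      flip_code j (flip_code i t) \in K]) K].

Fixpoint valid_steps (K : seq (seq bool)) (sts : seq kill_step) : bool :=
  if sts is st :: sts' then
    valid_step K st && valid_steps (step_target st :: K) sts'
  else true.

Fixpoint killed (K : seq (seq bool)) (sts : seq kill_step) : seq (seq bool) :=
  if sts is st :: sts' then killed (step_target st :: K) sts' else K.

Definition base_spinor (k : fieldType) : spinor k 6 :=
  [ffun S => (code S \in pivots)%:R].

Lemma generic_kill_steps (k : fieldType) r (Y : alg_functor k) K sts :
    valid_steps K sts ->
    generic_near (base_spinor k)
      [set x | forall S, code S \in killed K sts -> x S = 0]
      (fun x => isomorphic (zero_locus r x) Y) ->
  generic_near (base_spinor k) [set x | forall S, code S \in K -> x S = 0]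
    (fun x => isomorphic (zero_locus r x) Y).
Proof.
elim: sts K => //= -[[[[c i] d] j] s] sts IH K /andP[].
case/and5P => ij i6 j6 /eqP c1 /and4P[/eqP d1 sP s1P /allP allK] vs gen.
have {IH vs gen} := IH _ vs gen; set i' := Ordinal i6; set j' := Ordinal j6.
have s6 : size s = 6 by move: sP; rewrite !inE => /or4P[] /eqP->.
have S1E : code (flip i' (flip j' (decode s))) = flip_code i (flip_code j s).
  by rewrite !code_flip decodeK.
have in1 (l : 'I_6) : (l \in flip i' (flip j' (decode s)))
   = nth false (flip_code i (flip_code j s)) l.
  by rewrite -nth_code S1E.
apply: (@generic_kill _ _ _ _ _ _ _ (decode s) c i' d j').
- by [].
- by rewrite in1.
- by rewrite in1.
- by rewrite ffunE decodeK // sP.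
- by rewrite ffunE S1E (negPf s1P).
- move=> S /=; rewrite inE => /orP[/eqP SE|KS]; [right|by left].
  by rewrite /= -[S]codeK SE -S1E codeK.
- move=> S KS; have := allK _ KS; rewrite -!nth_code /= => /or4P[/eqP//|/eqP//|
  |].
    by move=> /eqP SE _ _ /eqP[]; rewrite -[S]codeK SE -S1E codeK.
  by rewrite !code_flip.
Qed.

(* Three rounds: the pivot 1 kills the pairs; e_0123 kills the sets of four
   elements containing exactly one of 4 and 5; e_0145 kills those containing 4
   and 5 and exactly one of 0 and 1. *)
Definition reduction : seq kill_step :=
  [seq (true, ij.1, true, ij.2, nseq 6 false)
     | ij <- allpairs pair (iota 0 6) (iota 0 6) & (ij.1 < ij.2)%N]
  ++ [seq (true, i, false, j, [:: true; true; true; true; false; false])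
       | i <- [:: 4; 5], j <- iota 0 4]
  ++ [seq (true, i, false, j, [:: true; true; false; false; true; true])
       | i <- [:: 2; 3], j <- iota 0 2].

Lemma valid_reduction :
  valid_steps [seq s <- all_codes 6 | odd (count id s)] reduction.
Proof. by vm_compute. Qed.

Lemma killed_reduction :
  all (fun s => (s \in nseq 6 true :: pivots)
    || (s \in killed [seq s <- all_codes 6 | odd (count id s)] reduction))
      (all_codes 6).
Proof. by vm_compute. Qed.

Lemma generic_normal_form (k : fieldType) r (Y : alg_functor k) :
    generic_near (base_spinor k)
      [set x | forall S, code S \notin nseq 6 true :: pivots -> x S = 0]
      (fun x => isomorphic (zero_locus r x) Y) ->
  generic_near (base_spinor k) (@even_spinor k 6)
    (fun x => isomorphic (zero_locus r x) Y).
Proof.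
move=> gen.
have -> : @even_spinor k 6 = [set x | forall S,
    code S \in [seq s <- all_codes 6 | odd (count id s)] -> x S = 0].
  apply/seteqP; split=> x x0 S.
    by rewrite mem_filter odd_code => /andP[/x0].
  move=> oS; apply: x0; rewrite mem_filter odd_code oS.
  by have := mem_all_codes (code S); rewrite size_code.
apply: (generic_kill_steps valid_reduction).
case: gen => f [pf f0 fQ]; exists f; split=> // x x0; apply: fQ => S nS;
  apply: x0.
have /allP/(_ (code S)) := killed_reduction.
by have := mem_all_codes (code S); rewrite size_code (negPf nS) => -> /(_ isT).
Qed.

(** * Tensors of format 2 x 2 x 2 *)

Lemma ext_sign_next (A : comNzRingType) n (i j : 'I_n) S : j = i.+1 :> nat ->
  ext_sign A j S = ext_sign A i S * (-1) ^+ (i \in S).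
Proof.
move=> ji; rewrite !ext_sign_prod [LHS](bigD1 i) /= ?ji // mulrC; congr (_ * _).
by apply: eq_bigl => l; rewrite ltnS -val_eqE /= ltn_neqAle andbC.
Qed.

(** For consecutive indices the two exterior signs combine to [- (-1) ^+ c], whatever the rest of
    [S]. The same factor in the parameter compensates it. *)
Lemma next_transvectionE (k : fieldType) n (t : k) (c : bool) (i j : 'I_n)
  (x : spinor k n) S :
    j = i.+1 :> nat ->
  spinor_transvection ((- (-1) ^+ c * t) *: basis_vec k c i) (basis_vec k c j)
    x S
    = x S + (if ((i \in S) == c) && ((j \in S) == c)
             then t * x (flip j (flip i S)) else 0).
Proof.
move=> ji; have ij : i != j by rewrite -val_eqE /= ji ltn_eqF.
rewrite basis_transvectionE //; case: ifP => [/andP[/eqP iS _]|_];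
  last by rewrite mulr0.
rewrite /pair_sign ext_sign_flip (ext_sign_next _ _ ji) iS ji ltnSn /=.
have s2 := ext_sign_sqr k i S.
have c2 : (-1) ^+ c * (-1) ^+ c = 1 :> k by rewrite -expr2 sqrr_sign.
congr (_ + _); transitivity (((-1) ^+ c * (-1) ^+ c)
  * (ext_sign k i S * ext_sign k i S) * (t * x (flip j (flip i S))));
    first by ring.
by rewrite s2 c2 !mul1r.
Qed.

(* Spinors that are sums of products of pairs of consecutive basis vectors are
   tensors in (k^2)^{\otimes 3}, and 1 + t e_i e_(i+1) acts by a transvection on
   one of the factors. *)
Definition tensor_spinor (k : fieldType) (f : bool -> bool -> bool -> k) :
  spinor k 6 :=
  [ffun S => let s := code S in
     if [&& nth false s 0 == nth false s 1, nth false s 2 == nth false s 3 &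
            nth false s 4 == nth false s 5]
     then f (nth false s 0) (nth false s 2) (nth false s 4) else 0].

Definition elementary (k : fieldType) (c : bool) (t : k) (u : bool -> k)
  (b : bool) : k :=
  u b + (if b == c then t * u (~~ b) else 0).

(** Elementary matrices generate SL_2, so these moves in the pairs 01, 23 and 45 give the action of
    SL_2^3. *)
Lemma tensor_elementary_isomorphic (k : fieldType) r c t
    (f : bool -> bool -> bool -> k) :
  [/\ isomorphic (zero_locus r (tensor_spinor f)) (zero_locus r (tensor_spinor
        (fun b1 b2 b3 => elementary c t (fun b => f b b2 b3) b1))),
      isomorphic (zero_locus r (tensor_spinor f)) (zero_locus r (tensor_spinor
        (fun b1 b2 b3 => elementary c t (fun b => f b1 b b3) b2))) &
      isomorphic (zero_locus r (tensor_spinor f)) (zero_locus r (tensor_spinor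
        (fun b1 b2 b3 => elementary c t (fun b => f b1 b2 b) b3)))].
Proof.
have step (i j : 'I_6) g : j = i.+1 :> nat ->
    (forall S, tensor_spinor g S = tensor_spinor f S
       + (if (nth false (code S) i == c) && (nth false (code S) j == c)
          then t * tensor_spinor f (flip j (flip i S)) else 0)) ->
    isomorphic (zero_locus r (tensor_spinor f))
      (zero_locus r (tensor_spinor g)).
  move=> ji gE; have ij : i != j by rewrite -val_eqE /= ji ltn_eqF.
  have -> : tensor_spinor g = spinor_transvection
      ((- (-1) ^+ c * t) *: basis_vec k c i) (basis_vec k c j)
        (tensor_spinor f).
    by apply/ffunP => S; rewrite gE next_transvectionE // !nth_code.
  exact: basis_transvection_isomorphic.
split.
- apply: (step (@Ordinal 6 0 isT) (@Ordinal 6 1 isT)) => // S.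
  rewrite !ffunE !code_flip; move: (size_code S) => /=.
  case: (code S) => [|b0 [|b1 [|b2 [|b3 [|b4 [|b5 [|]]]]]]] //= _.
  rewrite /elementary; case: b0 b1 (c) => [] [] [];
    rewrite //= ?addr0 ?mulr0 //;
   by case: ifP; rewrite ?mulr0 ?addr0.
- apply: (step (@Ordinal 6 2 isT) (@Ordinal 6 3 isT)) => // S.
  rewrite !ffunE !code_flip; move: (size_code S) => /=.
  case: (code S) => [|b0 [|b1 [|b2 [|b3 [|b4 [|b5 [|]]]]]]] //= _.
  rewrite /elementary; case: b2 b3 (c) => [] [] [];
    rewrite //= ?andbF ?addr0 ?mulr0 //;
   by case: ifP; rewrite ?mulr0 ?addr0.
- apply: (step (@Ordinal 6 4 isT) (@Ordinal 6 5 isT)) => // S.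
  rewrite !ffunE !code_flip; move: (size_code S) => /=.
  case: (code S) => [|b0 [|b1 [|b2 [|b3 [|b4 [|b5 [|]]]]]]] //= _.
  rewrite /elementary; case: b4 b5 (c) => [] [] [];
    rewrite //= ?andbF ?addr0 ?mulr0 //;
   by case: ifP; rewrite ?mulr0 ?addr0.
Qed.

Definition two_term (k : fieldType) (al al' : k) (u v w u' v' w' : bool -> k)
    (b1 b2 b3 : bool) : k :=
  al * (u b1 * v b2 * w b3) + al' * (u' b1 * v' b2 * w' b3).

Lemma two_term_isomorphic (k : fieldType) r c t (al al' : k)
  (u v w u' v' w' : bool -> k) :
  let X u v w u' v' w' :=
    zero_locus r (tensor_spinor (two_term al al' u v w u' v' w')) in
  let E := elementary c t in
  [/\ isomorphic (X u v w u' v' w') (X (E u) v w (E u') v' w'),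
      isomorphic (X u v w u' v' w') (X u (E v) w u' (E v') w') &
      isomorphic (X u v w u' v' w') (X u v (E w) u' v' (E w'))].
Proof.
move=> X E; have [i1 i2 i3] := tensor_elementary_isomorphic r c t
  (two_term al al' u v w u' v' w').
split; [move: i1|move: i2|move: i3]; congr (isomorphic _ (zero_locus _
  (tensor_spinor _)));
  apply/funext => b1; apply/funext => b2; apply/funext => b3;
  by rewrite /E /elementary /two_term; case: ifP => _; ring.
Qed.

Lemma two_term_isomorphic2 (k : fieldType) r t t' (al al' : k)
    (u v w u' v' w' : bool -> k) :
  let X u v w u' v' w' :=
    zero_locus r (tensor_spinor (two_term al al' u v w u' v' w')) in
  let E := fun u => elementary false t' (elementary true t u) in
  [/\ isomorphic (X u v w u' v' w') (X (E u) v w (E u') v' w'),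
      isomorphic (X u v w u' v' w') (X u (E v) w u' (E v') w') &
      isomorphic (X u v w u' v' w') (X u v (E w) u' v' (E w'))].
Proof.
move=> X E; have [i1 i2 i3] := two_term_isomorphic r true t al al' u v w u' v'
  w'.
split; [apply: isomorphic_trans i1 _|apply: isomorphic_trans i2 _|
        apply: isomorphic_trans i3 _].
- by have [] := two_term_isomorphic r false t' al al' (elementary true t u) v w
    (elementary true t u') v' w'.
- by have [] := two_term_isomorphic r false t' al al' u (elementary true t v) w
    u' (elementary true t v') w'.
- by have [] := two_term_isomorphic r false t' al al' u v (elementary true t w)
    u' v' (elementary true t w').
Qed.

(* The vector (1, x) of k^2. *)
Definition affine_vec (k : fieldType) (x : k) (b : bool) : k :=
  if b then x else 1.

(** The first matrix sends (1, x) and (1, y) to (1, 0) and (1, y - x). The second clears the first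
    entry of the latter. *)
Lemma elementary_affine_vec (k : fieldType) (x y : k) : x != y ->
  let E := fun u => elementary false (- (y - x)^-1) (elementary true (- x) u) in
  E (affine_vec x) = (fun b => if b then 0 else 1) /\
  E (affine_vec y) = (fun b => if b then y - x else 0).
Proof.
move=> xy E; have yx : y - x != 0 by rewrite subr_eq0 eq_sym.
by split; apply/funext => -[]; rewrite /E /elementary /affine_vec /=; field.
Qed.

Lemma decode_nseq b :
  decode (nseq 6 b) = if b then finset.setT else finset.set0.
Proof. by apply/setP => i; rewrite inE nth_nseq ltn_ord; case: b; rewrite inE.
Qed.

Lemma tensor_spinor_extremal (k : fieldType) (a b : k) :
  tensor_spinor (fun b1 b2 b3 => if [&& b1, b2 & b3] then b
                                 else if [|| b1, b2 | b3] then 0 else a)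
    = extremal_spinor 6 a b.
Proof.
apply/ffunP => S; rewrite !ffunE; have sS := size_code S.
have eqS c : (S == decode (nseq 6 c)) = (code S == nseq 6 c).
  by rewrite -(inj_eq (can_inj codeK)) decodeK // size_nseq.
rewrite -(decode_nseq false) -(decode_nseq true) !eqS.
case: (code S) sS => [|b0 [|b1 [|b2 [|b3 [|b4 [|b5 [|]]]]]]] //= _.
by case: b0 b1 b2 b3 b4 b5 => [] [] [] [] [] [].
Qed.

Lemma isomorphic_refl (k : fieldType) (X : alg_functor k) : isomorphic X X.
Proof. by exists (fun=> id); split=> // A; exists id. Qed.

Lemma two_term_extremal_isomorphic (k : fieldType)
  r (al al' x y z x' y' z' : k) :
    x != x' -> y != y' -> z != z' ->
  isomorphic
    (zero_locus r (tensor_spinor (two_term al al' (affine_vec x) (affine_vec y)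
       (affine_vec z) (affine_vec x') (affine_vec y') (affine_vec z'))))
    (zero_locus r (extremal_spinor 6 al (al' * ((x' - x) * (y' - y)
      * (z' - z))))).
Proof.
move=> xx yy zz; rewrite -tensor_spinor_extremal.
have two t t' u v w u' v' w' := two_term_isomorphic2 r t t' al al' u v w u' v'
  w'.
have [ex ex'] := elementary_affine_vec xx.
have [+ _ _] := two (- x) (- (x' - x)^-1) (affine_vec x) (affine_vec y)
  (affine_vec z) (affine_vec x') (affine_vec y') (affine_vec z').
rewrite ex ex' => i1; apply: isomorphic_trans i1 _.
have [ey ey'] := elementary_affine_vec yy.
have [_ + _] := two (- y) (- (y' - y)^-1) (fun b => if b then 0 else 1)
  (affine_vec y)
  (affine_vec z) (fun b => if b then x' - x else 0) (affine_vec y')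
    (affine_vec z').
rewrite ey ey' => i2; apply: isomorphic_trans i2 _.
have [ez ez'] := elementary_affine_vec zz.
have [_ _ +] := two (- z) (- (z' - z)^-1) (fun b => if b then 0 else 1)
  (fun b => if b then 0 else 1) (affine_vec z)
    (fun b => if b then x' - x else 0)
  (fun b => if b then y' - y else 0) (affine_vec z').
rewrite ez ez' => i3; apply: isomorphic_trans i3 _.
rewrite (_ : two_term _ _ _ _ _ _ _ _ = fun b1 b2 b3 => if [&& b1, b2 & b3]
  then al' * ((x' - x) * (y' - y) * (z' - z))
    else if [|| b1, b2 | b3] then 0 else al).
  exact: isomorphic_refl.
apply/funext => b1; apply/funext => b2; apply/funext => b3; rewrite /two_term.
by case: b1 b2 b3 => [] [] [] /=; ring.
Qed.

(** The tensor has entry [a] at 000, zeros in weight one, [c3], [c2], [c1] in weight two and [b] at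
    111. It is written as a sum of two decomposable tensors with factors of the form (1, x);
    algebraic closedness supplies one square root. *)
Lemma two_term_decomposition (k : numClosedFieldType) (a b c1 c2 c3 : k) :
    a != 0 -> c1 != 0 -> c2 != 0 -> c3 != 0 ->
    a * b ^+ 2 + 4 * (c1 * c2 * c3) != 0 ->
  exists al al' x y z x' y' z' : k,
    [/\ al != 0, al' != 0, x != x', y != y' & z != z'] /\
    [/\ al + al' = a, al * x + al' * x' = 0, al * y + al' * y' = 0 &
        al * z + al' * z' = 0] /\
    [/\ al * (x * y) + al' * (x' * y') = c3,
        al * (x * z) + al' * (x' * z') = c2,
        al * (y * z) + al' * (y' * z') = c1 &
        al * (x * y * z) + al' * (x' * y' * z') = b].
Proof.
move=> a0 c10 c20 c30; set E := a * b ^+ 2 + _ => E0.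
(* In the notation of the lemma one can take x = al' X and x' = - al X, and
   similarly Y for y and Z for z. With p = al al' the remaining equations become
   p a Y Z = c1, p a X Z = c2, p a X Y = c3 and p a (al' - al) X Y Z = b; they
   force p E = a^2 c1 c2 c3. Here a E is Cayley's hyperdeterminant. *)
have [p p0 pE] : exists2 p, p != 0 & p * E = a ^+ 2 * (c1 * c2 * c3).
  exists (a ^+ 2 * (c1 * c2 * c3) / E); last by rewrite divfK.
  by rewrite !mulf_neq0 ?invr_eq0 ?expf_neq0.
have [X X2] : exists X, X ^+ 2 = c2 * c3 / (c1 * p * a).
  by exists (2.-root (c2 * c3 / (c1 * p * a))); rewrite Num.Theory.rootCK.
have X0 : X != 0.
  by rewrite -sqrf_eq0 X2 !mulf_neq0 ?invr_eq0 ?mulf_neq0.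
have X2' : X ^+ 2 * (c1 * p * a) = c2 * c3.
  by rewrite X2 divfK ?mulf_neq0.
(* The equations for [c3] and [c2] force [Y] and [Z], and the one for [b] then forces [d], the
   future [al' - al]. The identity [d2] makes [al] and [al'] the roots of T^2 - a T + p. *)
clear X2; pose Y := c3 / (p * a * X); pose Z := c2 / (p * a * X).
pose d := b * p * a * X / (c2 * c3).
have two0 : 2 != 0 :> k by rewrite pnatr_eq0.
have dE : d * (c2 * c3) = b * p * a * X by rewrite divfK ?mulf_neq0.
have d2 : d ^+ 2 = a ^+ 2 - 4 * p.
  apply: (mulfI (mulf_neq0 (mulf_neq0 c20 c20) (mulf_neq0 c30 c30))).
  apply: (mulfI (mulf_neq0 c10 a0)).
  transitivity (c1 * a * (d * (c2 * c3)) ^+ 2); first by ring.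
  rewrite dE; transitivity (a ^+ 2 * b ^+ 2 * p * (X ^+ 2 * (c1 * p * a)));
    first by ring.
  rewrite X2'; transitivity (a * (c2 * c3) * (p * E - 4 * p * (c1 * c2 * c3))).
    by rewrite /E; ring.
  by rewrite pE; ring.
pose al := (a - d) / 2; pose al' := (a + d) / 2.
have alal' : al * al' = p.
  apply: (mulfI (mulf_neq0 two0 two0)); transitivity (a ^+ 2 - d ^+ 2).
    by rewrite /al /al'; field.
  by rewrite d2; ring.
have al_sum : al + al' = a by rewrite /al /al'; field.
have al_diff : al' - al = d by rewrite /al /al'; field.
have [al0 al'0] : al != 0 /\ al' != 0.
  by apply/andP; rewrite -negb_or -mulf_eq0 alal'.
have neq t : t != 0 -> al' * t != - al * t.
  move=> t0; rewrite -subr_eq0.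
  by rewrite (_ : _ - _ = a * t) ?mulf_neq0 // -al_sum; ring.
have Y0 : Y != 0 by rewrite !mulf_neq0 ?invr_eq0 ?mulf_neq0.
have Z0 : Z != 0 by rewrite !mulf_neq0 ?invr_eq0 ?mulf_neq0.
have XY : p * a * (X * Y) = c3 by rewrite /Y; field; rewrite p0 a0 X0.
have XZ : p * a * (X * Z) = c2 by rewrite /Z; field; rewrite p0 a0 X0.
have YZ : p * a * (Y * Z) = c1.
  apply: (mulfI (mulf_neq0 (mulf_neq0 p0 a0) (expf_neq0 2 X0))).
  transitivity (p * a * (X * Y) * (p * a * (X * Z))); first by ring.
  by rewrite XY XZ mulrC -X2'; ring.
have pair t t' : al * (al' * t * (al' * t')) + al' * (- al * t * (- al * t'))
    = p * a * (t * t').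
  by rewrite -alal' -al_sum; ring.
exists al, al', (al' * X), (al' * Y), (al' * Z), (- al * X), (- al * Y), (- al *
  Z).
split; [by split; rewrite ?neq|split; split].
- exact: al_sum.
- by ring.
- by ring.
- by ring.
- by rewrite pair.
- by rewrite pair.
- by rewrite pair.
transitivity (d * (p * a * (X * Y)) * Z);
  first by rewrite -alal' -al_diff -al_sum; ring.
rewrite XY; apply: (mulfI (mulf_neq0 (mulf_neq0 p0 a0) X0)).
transitivity (d * (p * a * (X * Z) * c3)); first by ring.
by rewrite XZ dE; ring.
Qed.

(** * The zero locus of a general section *)

Lemma generic_zero_locus_isomorphic (k : numClosedFieldType) :
  for_general (@even_spinor k 6)
    (fun s : spinor k 6 => isomorphic (zero_locus 2 s) (flag_variety k 6)).
Proof.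
have even_base : @even_spinor k 6 (base_spinor k).
  move=> S; rewrite ffunE -odd_code !inE => oS.
  case: or4P => // -[]/eqP e; by rewrite e in oS.
apply: (generic_near_for_general even_base); apply: generic_normal_form.
pose x_ (bs : seq bool) (x : spinor k 6) := x (decode bs).
pose a := x_ [:: false; false; false; false; false; false].
pose b := x_ [:: true; true; true; true; true; true].
pose c1 := x_ [:: false; false; true; true; true; true].
pose c2 := x_ [:: true; true; false; false; true; true].
pose c3 := x_ [:: true; true; true; true; false; false].
(* The factors are the quantities that [two_term_decomposition] needs to be nonzero. At
   [base_spinor] one has [a = c1 = c2 = c3 = 1] and [b = 0], and the product is 4. *)
exists (fun x => a x * (c1 x * (c2 x * (c3 x
  * (a x * (b x * b x) + 4 * (c1 x * (c2 x * c3 x))))))); split.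
- by repeat first [apply: polyfun_mul | apply: polyfun_add | apply:
  polyfun_const |
    apply: polyfun_coord].
- rewrite /a /b /c1 /c2 /c3 /x_ !ffunE !decodeK // !inE /=.
  by rewrite !mul1r !mul0r add0r mulr1 pnatr_eq0.
move=> x /= x0; rewrite !mulf_eq0 !negb_or => /and5P[a0 c10 c20 c30 E0].
have {}E0 : a x * b x ^+ 2 + 4 * (c1 x * c2 x * c3 x) != 0 by rewrite -mulrA.
have [al [al' [y [z [w [y' [z' [w' [[al0 al'0 yy zz ww] [[e0 ey ez ew] [eyz eyw
  ezw eyzw]]]]]]]]]]] :=
  two_term_decomposition a0 c10 c20 c30 E0.
have -> : x = tensor_spinor (two_term al al' (affine_vec y) (affine_vec z)
    (affine_vec w) (affine_vec y') (affine_vec z') (affine_vec w')).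
  apply/ffunP => S; rewrite ffunE -[in LHS](codeK S) /=.
  have := x0 S; rewrite !inE -[in x S](codeK S).
  move: (size_code S); case: (code S) => [|b0 [|b1 [|b2 [|b3 [|b4 [|b5 [|]]]]]]]
    //= _.
  rewrite /two_term /affine_vec.
  case: b0 b1 b2 b3 b4 b5 => [] [] [] [] [] [] //= xS;
    rewrite ?(mul1r, mulr1) ?(e0, ey, ez, ew, eyz, eyw, ezw, eyzw);
      by [apply: xS|].
apply: isomorphic_trans (two_term_extremal_isomorphic 2 al al' yy zz ww) _.
apply: zero_locus_extremal_isomorphic => //.
by rewrite !mulf_neq0 // subr_eq0 eq_sym.
Qed.

Theorem proposition24 (R : realType) :
  for_general (@even_spinor R[i] 6)
    (fun s : spinor R[i] 6 =>
       isomorphic (zero_locus 2 s) (flag_variety R[i] 6)).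
Proof. exact: generic_zero_locus_isomorphic. Qed.
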